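(* For all integers $n\ge 0$, $$c\phi_{18}(3n+1)\equiv 0\pmod{81},\qquad c\phi_{18}(3n+2)\equiv 0\pmod{2187}.$$
   Context: For a positive integer $k$ and an integer $n\ge 0$, $c\phi_k(n)$ denotes the number of $k$-colored generalized Frobenius partitions of $n$ (Andrews): two-rowed arrays $\begin{pmatrix} a_1 & a_2 & \cdots & a_r\\ b_1 & b_2 & \cdots & b_r\end{pmatrix}$ (with $r\ge 0$) in which every entry is a non-negative integer carrying one of $k$ colors, no integer occurs twice in the same color in the same row, each row is arranged in non-increasing order (equal integers being ordered by a fixed order on colors, so that a row is just a set of $r$ colored non-negative integers), and $n=r+\sum_{j=1}^r(a_j+b_j)$ (colors do not contribute to the sum). Equivalently, $\sum_{n\ge0}c\phi_k(n)q^n$ is the coefficient of $z^0$ in $\prod_{j\ge 0}(1+zq^{j+1})^k(1+z^{-1}q^{j})^k$. *)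

(* Defs.v *)
From mathcomp Require Import all_boot.

Set Implicit Arguments.
Unset Strict Implicit.
Unset Printing Implicit Defensive.

(* A row of colored integers, pairwise distinct as colored integers and listed
   in a fixed order, is encoded as a set of pairs (integer, color).  Every
   entry of an array of n with r >= 1 columns is at most n - r < n, so entries
   range over 'I_n without loss; for n = 0 only the empty array remains. *)
Definition colored_row (k n : nat) : finType := {set 'I_n * 'I_k}.

Definition row_sum (k n : nat) (A : colored_row k n) : nat :=
  \sum_(x in A) (x.1 : nat).

Definition gen_frob_partitions (k n : nat) :
    {set colored_row k n * colored_row k n} :=
  [set AB : colored_row k n * colored_row k n |
    (#|AB.1| == #|AB.2|) && (n == #|AB.1| + (row_sum AB.1 + row_sum AB.2))].

Definition cphi (k n : nat) : nat := #|gen_frob_partitions k n|.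

(* Main.v *)
(** By the Jacobi triple product, the generating function of cphi_18 is the
    constant term in z of kappa^18 theta^18, where kappa is the partition
    generating function and theta = sum z^n q^(n(n+1)/2).

    Write U(z) = theta(z/q; q^3), let T0, T1, T2 be the sections of theta by the
    exponent of z modulo 3, and let X = theta(z^3; q^3) have the corresponding
    sections X0, X1, X2.  A theta function is determined by its functional
    equation and finitely many coefficients, whence
      U^3 = a(q^3) T0 + c(q^3) (T1 + T2),
      T0^3 = a(q^9) X0 + c(q^9) (X1 + X2)  and its cyclic shifts,
      T0 T1 T2 = x X,
    with a, c the Borwein functions.  Comparing norms and sections of these
    identities gives, with A = a(q^9) and y = c(q^9)/3, that c(q^3) = 3 x,
    a(q^3) = A + 6 y and x^3 = y (A^2 + 3 A y + 9 y^2), while the norm of the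
    infinite product gives kappa(q)^3 (a(q^3) - c(q^3)) = kappa(q^3).

    So the constant term of U^18 is sigma P(A, y) + tau Q(A, y), with sigma, tau
    the constant terms of X0^2 and X1 X2.  As A and sigma are series in q^9 and
    y, tau are q^3 times such series, the residue of n modulo 3 is read off from
    the exponent of y modulo 3 once the powers of A - 3 y are cleared from the
    denominator, and the congruences become divisibilities of coefficients of
    explicit polynomials. *)

Require Import Defs.
From HB Require Import structures.
From mathcomp Require Import all_boot all_order all_algebra.
From mathcomp Require Import boolp classical_sets functions cardinality fsbigop.
From mathcomp Require Import zify ring.

Set Implicit Arguments.
Unset Strict Implicit.
Unset Printing Implicit Defensive.

Import Order.TTheory GRing.Theory Num.Theory.

Local Open Scope ring_scope.

(** * Power series *)

(** The record keeps the Cauchy product apart from the pointwise structure on functions, and the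
    construction can be iterated to get two variables. *)
Record series (R : Type) := Series { scoef : nat -> R }.

HB.instance Definition _ (R : Type) := gen_eqMixin (series R).
HB.instance Definition _ (R : Type) := gen_choiceMixin (series R).

Lemma series_eqP (R : Type) (f g : series R) : (forall n, scoef f n = scoef g n) -> f = g.
Proof. by case: f g => f [g] /= /funext ->. Qed.

Section SeriesRing.
Variable R : comNzRingType.
Implicit Types f g h : series R.

Definition sadd f g := Series (fun n => scoef f n + scoef g n).
Definition sopp f := Series (fun n => - scoef f n).
Definition szero : series R := Series (fun _ => 0).
Definition sone : series R := Series (fun n => (n == 0%N)%:R).
Definition smul f g :=
  Series (fun n => \sum_(i < n.+1) scoef f i * scoef g (n - i)%N).

Fact saddA : associative sadd.
Proof. by move=> f g h; apply: series_eqP => n /=; rewrite addrA. Qed.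
Fact saddC : commutative sadd.
Proof. by move=> f g; apply: series_eqP => n /=; rewrite addrC. Qed.
Fact sadd0 : left_id szero sadd.
Proof. by move=> f; apply: series_eqP => n /=; rewrite add0r. Qed.
Fact saddN : left_inverse szero sopp sadd.
Proof. by move=> f; apply: series_eqP => n /=; rewrite addNr. Qed.

HB.instance Definition _ := GRing.isZmodule.Build (series R) saddA saddC sadd0 saddN.

Definition strunc N f : {poly R} := \poly_(i < N) scoef f i.

(** Coefficients of index below [N] of a product depend only on the truncations, so commutativity
    and associativity are inherited from polynomials. *)
Lemma scoef_mul_trunc N f g n : (n < N)%N ->
  scoef (smul f g) n = (strunc N f * strunc N g)`_n.
Proof.
move=> ltnN; rewrite coefM /=; apply: eq_bigr => i _.
have lt_i := ltn_ord i; by rewrite !coef_poly !ifT //; lia.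
Qed.

Lemma coefM_trunc N (p p' r : {poly R}) n : (n < N)%N ->
  (forall i, (i < N)%N -> p`_i = p'`_i) -> (p * r)`_n = (p' * r)`_n.
Proof.
move=> ltnN pp'; rewrite !coefM; apply: eq_bigr => i _.
by rewrite pp' //; have := ltn_ord i; lia.
Qed.

Lemma strunc_mul N f g i : (i < N)%N ->
  (strunc N (smul f g))`_i = (strunc N f * strunc N g)`_i.
Proof. by move=> ltiN; rewrite coef_poly ltiN (scoef_mul_trunc _ _ ltiN). Qed.

Fact smulC : commutative smul.
Proof.
by move=> f g; apply: series_eqP => n; rewrite !(@scoef_mul_trunc n.+1) // mulrC.
Qed.

Fact smulA : associative smul.
Proof.
move=> f g h; apply: series_eqP => n; rewrite !(@scoef_mul_trunc n.+1) //.
rewrite mulrC (coefM_trunc _ (ltnSn n) (@strunc_mul n.+1 g h)).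
rewrite [RHS](coefM_trunc _ (ltnSn n) (@strunc_mul n.+1 f g)).
by rewrite mulrC mulrA.
Qed.

Fact smul1 : left_id sone smul.
Proof.
move=> f; apply: series_eqP => n /=.
rewrite big_ord_recl /= mul1r subn0 big1 ?addr0 // => i _.
by rewrite mul0r.
Qed.

Fact smulD : left_distributive smul sadd.
Proof.
move=> f g h; apply: series_eqP => n /=.
by rewrite -big_split /=; apply: eq_bigr => i _; rewrite mulrDl.
Qed.

Fact sone_neq0 : sone != 0.
Proof.
apply/eqP => /(congr1 (fun f => scoef f 0%N)) /= /eqP.
by rewrite oner_eq0.
Qed.

HB.instance Definition _ := GRing.Zmodule_isComNzRing.Build (series R)
  smulA smulC smul1 smulD sone_neq0.

Lemma scoefM f g n :
  scoef (f * g) n = \sum_(i < n.+1) scoef f i * scoef g (n - i)%N.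
Proof. by []. Qed.

Definition shead f := scoef f 0%N.

Fact shead_is_zmod : zmod_morphism shead.
Proof. by []. Qed.
Fact shead_is_monoid : monoid_morphism shead.
Proof. by split => // f g; rewrite /shead scoefM big_ord1. Qed.
HB.instance Definition _ := GRing.isZmodMorphism.Build (series R) R shead shead_is_zmod.
HB.instance Definition _ := GRing.isMonoidMorphism.Build (series R) R shead shead_is_monoid.

(** The lowest coefficient of a product is the product of the lowest non-zero coefficients.
    Integrality is stated as a plain hypothesis so that the lemma can be applied to itself for
    [series (series int)]. *)
Lemma series_mulf_eq0 : (forall a b : R, a * b = 0 -> a = 0 \/ b = 0) ->
  forall f g, f * g = 0 -> f = 0 \/ g = 0.
Proof.
move=> domR f g fg0.
have first h : h <> 0 -> exists2 m, scoef h m != 0 &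
    forall i, (i < m)%N -> scoef h i = 0.
  move=> h0; have exh : exists m, scoef h m != 0.
    apply: contrapT => /forallNP nh; apply: h0; apply: series_eqP => n.
    by apply/eqP; apply: contrapT => /negP; apply: nh.
  exists (ex_minn exh); case: ex_minnP => // m _ minm i ltim.
  by apply/eqP; apply: contraTT ltim => /minm; rewrite -leqNgt.
case: (pselect (f = 0)) => [|/first [m fm fl]]; first by left.
case: (pselect (g = 0)) => [|/first [k gk gl]]; first by right.
have := congr1 (fun h => scoef h (m + k)%N) fg0; rewrite /= .
have ltm : (m < (m + k).+1)%N by lia.
rewrite (bigD1 (Ordinal ltm)) //= big1 ?addr0; last first.
  move=> i /eqP nim; case: (ltngtP i m) => [/fl ->||eim]; first by rewrite mul0r.
    by move=> ltmi; rewrite gl ?mulr0 //; have := ltn_ord i; lia.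
  by case: nim; apply: val_inj.
by rewrite addKn => /domR [] /eqP; rewrite ?(negPf fm) ?(negPf gk).
Qed.

End SeriesRing.

(** * Bivariate series *)

(* The outer variable is t and the inner one s; the two variables of the
   Jacobi triple product are recovered as q = s t and z = 1/t = s/q. *)
Definition bis := series (series int).
HB.instance Definition _ := GRing.ComNzRing.on bis.

Definition bcoef (f : bis) (i j : nat) : int := scoef (scoef f j) i.
Definition mkbis (F : nat -> nat -> int) : bis :=
  Series (fun j => Series (fun i => F i j)).

(** Extension by zero to the whole lattice lets affine maps act on exponents without sign
    conditions; products become convolutions over the lattice. *)
Definition zcoef (f : bis) (u : int * int) : int :=
  if u is (Posz i, Posz j) then bcoef f i j else 0.

Lemma zcoefP (f g : bis) : (forall u, zcoef f u = zcoef g u) -> f = g.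
Proof.
move=> fg; apply: series_eqP => j; apply: series_eqP => i.
exact: (fg (Posz i, Posz j)).
Qed.

Lemma zcoef0 u : zcoef 0 u = 0.
Proof. by case: u => [[i|i] [j|j]]. Qed.
Lemma zcoefD f g u : zcoef (f + g) u = zcoef f u + zcoef g u.
Proof. by case: u => [[i|i] [j|j]]; rewrite /= ?addr0. Qed.
Lemma zcoefN f u : zcoef (- f) u = - zcoef f u.
Proof. by case: u => [[i|i] [j|j]]; rewrite /= ?oppr0. Qed.
Lemma zcoefB f g u : zcoef (f - g) u = zcoef f u - zcoef g u.
Proof. by rewrite zcoefD zcoefN. Qed.
Lemma zcoef1 u : zcoef 1 u = (u == 0)%:R.
Proof.
case: u => [[i|i] [j|j]] //=; last by rewrite xpair_eqE andbF.
by rewrite xpair_eqE /bcoef /=; case: j => [|j] /=; rewrite ?andbF ?andbT.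
Qed.

Lemma zcoef_neg f u : (u.1 < 0) || (u.2 < 0) -> zcoef f u = 0.
Proof. by case: u => [[i|i] [j|j]]. Qed.

Lemma bcoefM (f g : bis) i j : bcoef (f * g) i j =
  \sum_(b < j.+1) \sum_(a < i.+1) bcoef f a b * bcoef g (i - a) (j - b).
Proof.
rewrite /bcoef scoefM.
elim/big_rec2: _ => [|b x y _ <-] //.
Qed.

Lemma zcoefM (f g : bis) w :
  zcoef (f * g) w = \sum_(u \in [set: int * int]) zcoef f u * zcoef g (w - u).
Proof.
case: w => w1 w2.
have [neg|] := boolP ((w1 < 0) || (w2 < 0)).
  rewrite zcoef_neg // fsbig1 // => -[u1 u2] _.
  have [n1|n1] := boolP ((u1 < 0) || (u2 < 0)); first by rewrite zcoef_neg ?mul0r.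
  by rewrite (@zcoef_neg g) ?mulr0 //=; lia.
case: w1 w2 => [i|i] [j|j] // _.
rewrite [LHS]bcoefM.
rewrite (fsbigE [seq (Posz a, Posz b) | b <- iota 0 j.+1, a <- iota 0 i.+1]) //.
- under eq_bigl do rewrite in_setT.
  rewrite big_allpairs_dep -[iota 0 j.+1]/(index_iota 0 j.+1) big_mkord.
  apply: eq_bigr => b _.
  rewrite -[iota 0 i.+1]/(index_iota 0 i.+1) big_mkord; apply: eq_bigr => a _.
  have -> : ((Posz i, Posz j) - (Posz a, Posz b) : int * int) = (Posz (i - a), Posz (j - b)).
    by have := ltn_ord a; have := ltn_ord b; move=> *; congr pair => /=; lia.
  by [].
- apply: allpairs_uniq; rewrite ?iota_uniq // => -[a b] [c d] /= _ _.
  by case=> -> ->.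
- move=> [u1 u2] _ nin.
  have [n1|n1] := boolP ((u1 < 0) || (u2 < 0)); first by rewrite zcoef_neg ?mul0r.
  rewrite (@zcoef_neg g) ?mulr0 //=.
  move: nin n1; case: u1 u2 => [a|a] [b|b] // nin _.
  suff : ~~ ((a <= i) && (b <= j))%N by lia.
  apply: contra nin => /andP [ai bj]; apply/allpairsP; exists (b, a).
  by rewrite !mem_iota /=; split => //; lia.
Qed.

Lemma bis_mulf_eq0 (f g : bis) : f * g = 0 -> f = 0 \/ g = 0.
Proof.
apply: series_mulf_eq0; apply: series_mulf_eq0 => a b /eqP.
by rewrite mulf_eq0 => /orP[] /eqP ->; [left|right].
Qed.

Lemma bis_mulfI (f g h : bis) : f <> 0 -> f * g = f * h -> g = h.
Proof.
move=> f0 /eqP; rewrite -subr_eq0 -mulrBr => /eqP /bis_mulf_eq0 [//|].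
by move/eqP; rewrite subr_eq0 => /eqP.
Qed.

(** * Monomial substitutions *)

Lemma big_setT_range (F : int * int -> int) (h : int * int -> int * int) :
  injective h -> (forall w, (forall u, w <> h u) -> F w = 0) ->
  \sum_(u \in [set: int * int]) F u = \sum_(u \in [set: int * int]) F (h u).
Proof.
move=> injh F0; rewrite -(fsbig_widen (range h) setT) //.
  by rewrite fsbig_image // => x y _ _ /injh.
move=> w [_ /= nw]; apply: F0 => u wu; apply: nw; by exists u.
Qed.

Definition lin (a b c d : int) (u : int * int) : int * int :=
  (a * u.1 + b * u.2, c * u.1 + d * u.2).

Lemma linD a b c d : {morph lin a b c d : u v / u + v}.
Proof. by move=> [u1 u2] [v1 v2]; rewrite /lin; congr pair => /=; ring. Qed.

Lemma linB a b c d : {morph lin a b c d : u v / u - v}.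
Proof. by move=> [u1 u2] [v1 v2]; rewrite /lin; congr pair => /=; ring. Qed.

Lemma lin_inj a b c d : a * d - b * c != 0 -> injective (lin a b c d).
Proof.
move=> det [u1 u2] [v1 v2] [/= e1 e2].
have h1 : (a * d - b * c) * u1 = (a * d - b * c) * v1.
  transitivity (d * (a * u1 + b * u2) - b * (c * u1 + d * u2)); first by ring.
  by rewrite e1 e2; ring.
have h2 : (a * d - b * c) * u2 = (a * d - b * c) * v2.
  transitivity (a * (c * u1 + d * u2) - c * (a * u1 + b * u2)); first by ring.
  by rewrite e1 e2; ring.
by rewrite (mulfI det h1) (mulfI det h2).
Qed.

(* [transports M v h g]: h is obtained from g by moving each monomial with
   exponent u to the exponent M u + v.  This covers monomial substitutions as
   well as z -> z q^k, which does not act on the ring but does act on theta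
   functions. *)
Definition transports (M : int * int -> int * int) (v : int * int) (h g : bis) :=
  (forall u, zcoef h (M u + v) = zcoef g u) /\
  (forall w, (forall u, w <> M u + v) -> zcoef h w = 0).

Section Transports.
Variables a b c d : int.
Hypothesis det : a * d - b * c != 0.
Notation M := (lin a b c d).

(** By linearity of [M] the exponents [M x + v] and [M y + v'] add up to [M (x + y) + (v + v')];
    injectivity of [M] allows the convolution to be reindexed along [x]. *)
Lemma transports_mul v v' h h' g g' :
  transports M v h g -> transports M v' h' g' ->
  transports M (v + v') (h * h') (g * g').
Proof.
move=> [hg h0] [hg' h0']; split=> [u|w nw].
  rewrite !zcoefM (@big_setT_range _ (fun x => M x + v)).
  - apply: eq_fsbigr => x _; rewrite hg; congr (_ * _).
    by rewrite -hg' linB; congr zcoef; rewrite opprD addrACA [v + v']addrC addrK.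
  - by move=> x y /addIr /(lin_inj det).
  - by move=> x nx; rewrite h0 ?mul0r.
rewrite zcoefM fsbig1 // => x _.
case: (pselect (exists y, x = M y + v)) => [[y ->]|/forallNP nx]; last first.
  by rewrite h0 ?mul0r.
rewrite h0' ?mulr0 // => y' e; apply: (nw (y + y')).
by rewrite linD addrACA -e addrC subrK.
Qed.

Lemma transports_add v h h' g g' :
  transports M v h g -> transports M v h' g' -> transports M v (h + h') (g + g').
Proof.
move=> [hg h0] [hg' h0']; split=> [u|w nw]; rewrite !zcoefD ?hg ?hg' //.
by rewrite h0 ?h0'.
Qed.

Lemma transports_opp v h g : transports M v h g -> transports M v (- h) (- g).
Proof. by move=> [hg h0]; split=> [u|w nw]; rewrite !zcoefN ?hg // h0 ?oppr0. Qed.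

Lemma transports_one : transports M 0 1 1.
Proof.
have M0 : M 0 = 0 by rewrite /lin /= !mulr0.
split=> [u|w nw]; rewrite !zcoef1.
  by rewrite addr0 -{1}M0 (inj_eq (lin_inj det)).
by case: eqP => // w0; case: (nw 0); rewrite M0 w0 addr0.
Qed.

Lemma transports_uniq v h h' g : transports M v h g -> transports M v h' g -> h = h'.
Proof.
move=> [hg h0] [hg' h0']; apply: zcoefP => w.
case: (pselect (exists y, w = M y + v)) => [[y ->]|/forallNP nw].
  by rewrite hg hg'.
by rewrite h0 ?h0'.
Qed.

End Transports.

(* s -> s^3, t -> t^3 *)
Definition phi3 (f : bis) : bis :=
  mkbis (fun i j => if (3 %| i) && (3 %| j) then bcoef f (i %/ 3) (j %/ 3) else 0)%N.

(* s -> s^2 t, t -> s t^2 *)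
Definition chi (f : bis) : bis :=
  mkbis (fun i j => if [&& 3 %| i + j, i <= 2 * j & j <= 2 * i]
    then bcoef f ((2 * i - j) %/ 3) ((2 * j - i) %/ 3) else 0)%N.

Definition swap (f : bis) : bis := mkbis (fun i j => bcoef f j i).

Lemma zcoef_mkbis F (u : int * int) :
  zcoef (mkbis F) u = if (0 <= u.1) && (0 <= u.2) then F `|u.1|%N `|u.2|%N else 0.
Proof. by case: u => [[i|i] [j|j]]. Qed.

Lemma zcoefE f (u : int * int) :
  zcoef f u = if (0 <= u.1) && (0 <= u.2) then bcoef f `|u.1|%N `|u.2|%N else 0.
Proof. by case: u => [[i|i] [j|j]]. Qed.

Lemma phi3_transports f : transports (lin 3 0 0 3) 0 (phi3 f) f.
Proof.
split=> [[u1 u2]|[w1 w2] nw].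
  rewrite addr0 zcoef_mkbis zcoefE /lin /= !mul0r addr0 add0r.
  have -> : (0 <= 3 * u1) && (0 <= 3 * u2) = (0 <= u1) && (0 <= u2) by lia.
  by case: ifP => // _; rewrite ifT; [congr bcoef|]; lia.
rewrite zcoef_mkbis /=; case: ifP => // nn; case: ifP => // d3.
by case: (nw ((w1 %/ 3)%Z, (w2 %/ 3)%Z)); rewrite addr0 /lin /=; congr pair; lia.
Qed.

Lemma chi_transports f : transports (lin 2 1 1 2) 0 (chi f) f.
Proof.
split=> [[u1 u2]|[w1 w2] nw].
  rewrite addr0 zcoef_mkbis zcoefE /lin /= !mul1r.
  case: ifP => nn.
    case: ifP => c1.
      by rewrite ifT; [congr bcoef|]; lia.
    by rewrite ifF //; lia.
  by rewrite ifF //; lia.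
rewrite zcoef_mkbis /=; case: ifP => // nn; case: ifP => // d3.
case: (nw (((2 * w1 - w2) %/ 3)%Z, ((2 * w2 - w1) %/ 3)%Z)).
by rewrite addr0 /lin /=; congr pair; lia.
Qed.

Lemma swap_transports f : transports (lin 0 1 1 0) 0 (swap f) f.
Proof.
split=> [[u1 u2]|[w1 w2] nw].
  by rewrite addr0 zcoef_mkbis zcoefE /lin /= !mul0r !mul1r addr0 add0r andbC.
by case: (nw (w2, w1)); rewrite addr0 /lin /=; congr pair; lia.
Qed.

Section SubstMorphism.
Variables (a b c d : int) (F : bis -> bis).
Hypothesis det : a * d - b * c != 0.
Hypothesis FP : forall f, transports (lin a b c d) 0 (F f) f.

Lemma subst_is_zmod : zmod_morphism F.
Proof.
move=> f g; apply: transports_uniq (FP _) _.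
exact: transports_add (FP _) (transports_opp (FP _)).
Qed.

Lemma subst_is_monoid : monoid_morphism F.
Proof.
split; first exact: transports_uniq (FP _) (transports_one det).
by move=> f g; apply: transports_uniq (FP _) _; rewrite -(addr0 0); apply: transports_mul.
Qed.
End SubstMorphism.

HB.instance Definition _ := GRing.isZmodMorphism.Build bis bis phi3 (subst_is_zmod phi3_transports).
HB.instance Definition _ := GRing.isMonoidMorphism.Build bis bis phi3
  (subst_is_monoid (isT : 3 * 3 - 0 * 0 != 0 :> int) phi3_transports).
HB.instance Definition _ := GRing.isZmodMorphism.Build bis bis chi (subst_is_zmod chi_transports).
HB.instance Definition _ := GRing.isMonoidMorphism.Build bis bis chi
  (subst_is_monoid (isT : 2 * 2 - 1 * 1 != 0 :> int) chi_transports).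
HB.instance Definition _ := GRing.isZmodMorphism.Build bis bis swap (subst_is_zmod swap_transports).
HB.instance Definition _ := GRing.isMonoidMorphism.Build bis bis swap
  (subst_is_monoid (isT : 0 * 0 - 1 * 1 != 0 :> int) swap_transports).

Definition mono (a b : nat) : bis := mkbis (fun i j => ((i == a) && (j == b))%:R).

Arguments mono : simpl never.

Lemma zcoef_mono a b u : zcoef (mono a b) u = (u == (Posz a, Posz b))%:R.
Proof. by case: u => [[i|i] [j|j]] //=; rewrite xpair_eqE andbF. Qed.

Lemma zcoef_monoM a b f u : zcoef (mono a b * f) u = zcoef f (u - (Posz a, Posz b)).
Proof.
rewrite zcoefM -(fsbig_widen [set (Posz a, Posz b)] setT) //.
  by rewrite fsbig_set1 zcoef_mono eqxx mul1r.
move=> w [_ /= /eqP nw]; by rewrite zcoef_mono (negPf nw) mul0r.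
Qed.

Lemma monoM a b c d : mono a b * mono c d = mono (a + c) (b + d).
Proof.
apply: zcoefP => u; rewrite zcoef_monoM !zcoef_mono subr_eq.
by congr (_ == _)%:R; congr pair => /=; rewrite PoszD addrC.
Qed.

Lemma mono00 : mono 0 0 = 1.
Proof. by apply: zcoefP => u; rewrite zcoef_mono zcoef1. Qed.

Lemma transports_mono a b c d (x y x' y' : nat) v : a * d - b * c != 0 ->
  lin a b c d (Posz x, Posz y) + v = (Posz x', Posz y') ->
  transports (lin a b c d) v (mono x' y') (mono x y).
Proof.
move=> det e; split=> [u|w nw]; rewrite !zcoef_mono.
  by rewrite -e (inj_eq (@addIr _ v)) (inj_eq (lin_inj det)).
by case: eqP => // w0; case: (nw (Posz x, Posz y)); rewrite e.
Qed.

(** * Gradings by the exponents of z and q, where s^i t^j = z^(i - j) q^i *)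

Definition zdeg (u : int * int) : int := u.1 - u.2.
Definition qdeg (u : int * int) : int := u.1.

Lemma zdegD : {morph zdeg : u v / u + v}.
Proof. by move=> u v; rewrite /zdeg /=; ring. Qed.
Lemma qdegD : {morph qdeg : u v / u + v}. Proof. by []. Qed.

(* Modulus 0 means equality, so a series in q alone is one with
   [pure zdeg 0 0]. *)
Definition pure (l : int * int -> int) (m r : int) (f : bis) :=
  forall u, zcoef f u != 0 -> (m %| l u - r)%Z.

Definition part (l : int * int -> int) (m r : int) (f : bis) : bis :=
  mkbis (fun i j => if (m %| l (Posz i, Posz j) - r)%Z then bcoef f i j else 0).

Lemma zcoef_part l m r f u :
  zcoef (part l m r f) u = if (m %| l u - r)%Z then zcoef f u else 0.
Proof. by case: u => [[i|i] [j|j]] //=; case: ifP. Qed.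

Arguments zcoef : simpl never.
Arguments part : simpl never.

Fact part_is_zmod l m r : zmod_morphism (part l m r).
Proof.
by move=> f g; apply: zcoefP => u; rewrite !(zcoef_part, zcoefB); case: ifP; rewrite ?subr0.
Qed.
HB.instance Definition _ l m r :=
  GRing.isZmodMorphism.Build bis bis (part l m r) (part_is_zmod l m r).

Section Grading.
Variable l : int * int -> int.
Implicit Types (f g : bis) (m r : int).

Lemma pure_part m r f : pure l m r (part l m r f).
Proof. by move=> u; rewrite zcoef_part; case: ifP; rewrite ?eqxx. Qed.

Lemma part_id m r f : pure l m r f -> part l m r f = f.
Proof.
move=> pf; apply: zcoefP => u; rewrite zcoef_part.
by case: ifPn => // nd; apply/esym/eqP; apply: contraNT nd => /pf.
Qed.

Lemma part_eq0 m' m r r' f : pure l m' r f -> (m' %| m)%Z ->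
  ~~ (m' %| r' - r)%Z -> part l m r' f = 0.
Proof.
move=> pf dm nr; apply: zcoefP => u; rewrite zcoef_part zcoef0.
case: ifPn => // d; apply/eqP; apply: contraNT nr => /pf d'.
have -> : r' - r = (l u - r) - (l u - r') by ring.
by apply: rpredB => //; apply: dvdz_trans d.
Qed.

Lemma pure0 m r : pure l m r 0.
Proof. by move=> u; rewrite zcoef0 eqxx. Qed.

Lemma pureD m r f g : pure l m r f -> pure l m r g -> pure l m r (f + g).
Proof.
move=> pf pg u; rewrite zcoefD.
by case: (eqVneq (zcoef f u) 0) => [->|/pf //]; rewrite add0r => /pg.
Qed.

Lemma pureN m r f : pure l m r f -> pure l m r (- f).
Proof. by move=> pf u; rewrite zcoefN oppr_eq0 => /pf. Qed.

Lemma pureB m r f g : pure l m r f -> pure l m r g -> pure l m r (f - g).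
Proof. by move=> pf pg; apply: pureD => //; apply: pureN. Qed.

Lemma pureMn m r f n : pure l m r f -> pure l m r (f *+ n).
Proof. by move=> pf; elim: n => [|n IH]; [apply: pure0 | rewrite mulrS; apply: pureD]. Qed.

Lemma pure_mod m r r' f : pure l m r f -> (m %| r - r')%Z -> pure l m r' f.
Proof.
move=> pf d u /pf d'; have -> : l u - r' = (l u - r) + (r - r') by ring.
exact: rpredD.
Qed.

Lemma pure_dvd m m' r f : pure l m r f -> (m' %| m)%Z -> pure l m' r f.
Proof. by move=> pf d u /pf; apply: dvdz_trans. Qed.

Hypothesis lD : {morph l : u v / u + v}.

Let lB u w : l (w - u) = l w - l u.
Proof. by apply: (addIr (l u)); rewrite -lD !subrK. Qed.

Lemma pureM m r r' f g : pure l m r f -> pure l m r' g -> pure l m (r + r') (f * g).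
Proof.
move=> pf pg w; apply: contraR => nd; apply/eqP.
rewrite zcoefM fsbig1 // => u _.
case: (eqVneq (zcoef f u) 0) => [->|/pf df]; first by rewrite mul0r.
case: (eqVneq (zcoef g (w - u)) 0) => [->|/pg dg]; first by rewrite mulr0.
case/negP: nd; have -> : l w - (r + r') = (l u - r) + (l (w - u) - r').
  by rewrite lB; ring.
exact: rpredD.
Qed.

Lemma pure1 m : pure l m 0 1.
Proof.
have l0 : l 0 = 0 by apply: (addrI (l 0)); rewrite -lD !addr0.
move=> u; rewrite zcoef1 => /eqP; case: (eqVneq u 0) => [-> _|//].
by rewrite l0 subr0.
Qed.

Lemma pureX m r f n : pure l m r f -> pure l m (r * n%:Z) (f ^+ n).
Proof.
move=> pf; elim: n => [|n IH]; first by rewrite mulr0; apply: pure1.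
by rewrite exprS intS mulrDr mulr1; apply: pureM.
Qed.

Lemma part_mul m r d f : pure l m 0 d -> part l m r (d * f) = d * part l m r f.
Proof.
move=> pd; apply: zcoefP => w; rewrite zcoef_part !zcoefM.
case: ifPn => dw; last first.
  rewrite fsbig1 // => u _; rewrite zcoef_part.
  case: (eqVneq (zcoef d u) 0) => [->|/pd du]; first by rewrite mul0r.
  rewrite ifN ?mulr0 //; apply: contra dw => dw.
  have -> : l w - r = (l (w - u) - r) + (l u - 0) by rewrite lB; ring.
  exact: rpredD.
apply: eq_fsbigr => u _; rewrite zcoef_part.
case: (eqVneq (zcoef d u) 0) => [->|/pd du]; first by rewrite !mul0r.
rewrite ifT //; have -> : l (w - u) - r = (l w - r) - (l u - 0) by rewrite lB; ring.
exact: rpredB.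
Qed.

Lemma part_sum3 m r0 r1 r2 a b c :
  pure l m r0 a -> pure l m r1 b -> pure l m r2 c ->
  ~~ (m %| r0 - r1)%Z -> ~~ (m %| r0 - r2)%Z ->
  part l m r0 (a + b + c) = a.
Proof.
move=> pa pb pc n1 n2; rewrite !raddfD /= part_id //.
by rewrite (part_eq0 pb) // (part_eq0 pc) // !addr0.
Qed.

End Grading.

Lemma part3_decomp f : f = part zdeg 3 0 f + part zdeg 3 1 f + part zdeg 3 2 f.
Proof.
apply: zcoefP => u; rewrite !zcoefD !zcoef_part; move: (zdeg u) => x.
have [d0|[d1|d2]] : (3 %| x - 0)%Z \/ (3 %| x - 1)%Z \/ (3 %| x - 2)%Z by lia.
- by rewrite d0 !ifF ?addr0 //; lia.
- by rewrite d1 !ifF ?addr0 ?add0r //; lia.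
- by rewrite d2 !ifF ?addr0 ?add0r //; lia.
Qed.

(** * Truncation *)

(** For [m = 0] this is order at least [d] in the total degree, and [vanish 0 d (f - g)] says that f
    and g agree below degree [d]. *)
Definition vanish (m : int) (d : nat) (f : bis) :=
  forall u : int * int, u.1 + u.2 < d%:Z -> (m %| zcoef f u)%Z.

Lemma vanishD m d f g : vanish m d f -> vanish m d g -> vanish m d (f + g).
Proof. by move=> vf vg u du; rewrite zcoefD; apply: rpredD; [apply: vf | apply: vg]. Qed.

Lemma vanishN m d f : vanish m d f -> vanish m d (- f).
Proof. by move=> vf u du; rewrite zcoefN; apply: rpredNr; apply: vf. Qed.

Lemma vanish_le m d d' f : (d' <= d)%N -> vanish m d f -> vanish m d' f.
Proof. by move=> le_d vf u du; apply: vf; lia. Qed.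

Lemma vanishM m d e f g : vanish m d f -> vanish 0 e g -> vanish m (d + e) (f * g).
Proof.
move=> vf vg w dw; rewrite zcoefM; elim/big_ind: _ => [|x y|u _].
- exact: dvdz0.
- exact: rpredD.
case: (ltrP (u.1 + u.2) d%:Z) => du; first by apply: dvdz_mulr; apply: vf.
have /vg : (w - u).1 + (w - u).2 < e%:Z.
  by rewrite -[(w - u).1]/(w.1 - u.1) -[(w - u).2]/(w.2 - u.2); lia.
by rewrite dvd0z => /eqP ->; rewrite mulr0 dvdz0.
Qed.

Lemma vanish_any m f : vanish m 0 f.
Proof. move=> [u1 u2] /= du; rewrite zcoef_neg ?dvdz0 //=; lia. Qed.

Lemma vanishMr m d f g : vanish m d f -> vanish m d (f * g).
Proof. by move=> vf; rewrite -(addn0 d); apply: vanishM => //; apply: vanish_any. Qed.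

Lemma vanish_eq0 f : (forall d, vanish 0 d f) -> f = 0.
Proof.
move=> vf; apply: zcoefP => u; rewrite zcoef0.
pose x := (u.1 + u.2)%R; have /= := vf `|x|%N.+1 u.
rewrite -/x dvd0z => v; apply/eqP; apply: v; lia.
Qed.

Lemma vanish_zcoef d f g u : vanish 0 d (f - g) -> u.1 + u.2 < d%:Z -> zcoef f u = zcoef g u.
Proof. by move=> v /v; rewrite dvd0z zcoefB subr_eq0 => /eqP. Qed.

Lemma vanish_phi3 d f : vanish 0 d f -> vanish 0 d (phi3 f).
Proof.
have [fg f0] := phi3_transports f.
move=> vf w dw; case: (pselect (exists y, w = lin 3 0 0 3 y + 0)) => [[[y1 y2] e]|/forallNP nw].
  rewrite {}e in dw *; rewrite fg.
  case: (ltrP (y1 + y2) 0) => ny; first by rewrite zcoef_neg ?dvdz0 //=; lia.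
  by apply: vf; move: dw; rewrite /lin /=; lia.
by rewrite f0.
Qed.

Lemma vanish1_head f : zcoef f 0 = 0 -> vanish 0 1 f.
Proof.
move=> f0 [u1 u2] /= du; have [n|n] := boolP ((u1 < 0) || (u2 < 0)).
  by rewrite zcoef_neg ?dvdz0.
have -> : (u1, u2) = 0 :> (int * int)%type by congr pair; lia.
by rewrite f0 dvdz0.
Qed.

Definition head (f : bis) : int := shead (shead f).

Lemma headE f : head f = zcoef f 0. Proof. by []. Qed.

Fact head_is_zmod : zmod_morphism head. Proof. by []. Qed.
Fact head_is_monoid : monoid_morphism head.
Proof. by split => // f g; rewrite /head !rmorphM. Qed.
HB.instance Definition _ := GRing.isZmodMorphism.Build bis int head head_is_zmod.
HB.instance Definition _ := GRing.isMonoidMorphism.Build bis int head head_is_monoid.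

(** * Shifts z -> z q^k *)

(* [shift k d c h g] says h(z) = z^d q^c g(z q^k). *)
Definition shift (k d c : int) (h g : bis) :=
  transports (lin (1 + k) (- k) k (1 - k)) (c, c - d) h g.

Lemma shift_det k : (1 + k) * (1 - k) - (- k) * k != 0 :> int.
Proof. by have -> : (1 + k) * (1 - k) - (- k) * k = 1 by ring. Qed.

(** The exponent map has determinant 1, hence is onto the lattice, so the support condition of
    [transports] holds automatically. *)
Lemma shiftP k d c h g :
  (forall i j, zcoef h (i + k * (i - j) + c, j + k * (i - j) + c - d) = zcoef g (i, j)) ->
  shift k d c h g.
Proof.
move=> hg; have e (u : int * int) : lin (1 + k) (- k) k (1 - k) u + (c, c - d) =
    (u.1 + k * (u.1 - u.2) + c, u.2 + k * (u.1 - u.2) + c - d).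
  by rewrite /lin; congr pair => /=; ring.
split=> [[i j]|w nw]; first by rewrite e hg.
case: (nw (w.1 - c - k * (w.1 - w.2 - d), w.2 - c + d - k * (w.1 - w.2 - d))).
by rewrite e; case: w {nw} => w1 w2; congr pair => /=; ring.
Qed.

Lemma shift_zcoef k d c h g i j : shift k d c h g ->
  zcoef h (i + k * (i - j) + c, j + k * (i - j) + c - d) = zcoef g (i, j).
Proof.
case=> /(_ (i, j)) <- _; rewrite /lin; congr zcoef.
by congr pair => /=; ring.
Qed.

Lemma shiftM k d c d' c' h g h' g' : shift k d c h g -> shift k d' c' h' g' ->
  shift k (d + d') (c + c') (h * h') (g * g').
Proof.
move=> s1 s2; rewrite /shift.
have -> : (c + c', c + c' - (d + d')) = (c, c - d) + (c', c' - d') :> (int * int)%type.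
  by congr pair => /=; ring.
exact: transports_mul (shift_det k) _ _ _ _ _ _ s1 s2.
Qed.

Lemma shiftD k d c h g h' g' : shift k d c h g -> shift k d c h' g' ->
  shift k d c (h + h') (g + g').
Proof. exact: transports_add. Qed.

Lemma shiftN k d c h g : shift k d c h g -> shift k d c (- h) (- g).
Proof. exact: transports_opp. Qed.

Lemma shift_uniq k d c h h' g : shift k d c h g -> shift k d c h' g -> h = h'.
Proof. exact: transports_uniq. Qed.

Lemma shift_qseries k f : pure zdeg 0 0 f -> shift k 0 0 f f.
Proof.
move=> pf; apply: shiftP => i j; rewrite ?(addr0, subr0).
case: (eqVneq i j) => [->|nij]; first by rewrite subrr mulr0 !addr0.
transitivity (0 : int); [|symmetry]; apply/eqP; apply: contra_neqT nij => /pf;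
  rewrite dvd0z /zdeg /= subr0 subr_eq0 => /eqP; lia.
Qed.

Lemma shiftMl k d c f h g : pure zdeg 0 0 f -> shift k d c h g -> shift k d c (f * h) (f * g).
Proof.
by move=> pf s; have := shiftM (shift_qseries k pf) s; rewrite !add0r.
Qed.

(** The functional equation expresses the coefficient of z^(n + d) through that of z^n and
    conversely, so a window of d consecutive vanishing coefficients propagates, block by block, in
    both directions. *)
Lemma theta_unique k (d : nat) c (w : int) h : (0 < d)%N -> shift k d%:Z c h h ->
  (forall n : int, w <= n < w + d%:Z -> part zdeg 0 n h = 0) -> h = 0.
Proof.
move=> d0 sh win; apply: zcoefP => -[i j]; rewrite zcoef0.
have base i' j' : w <= i' - j' < w + d%:Z -> zcoef h (i', j') = 0.
  move=> b; have := congr1 (zcoef^~ (i', j')) (win (i' - j') b).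
  by rewrite zcoef_part zcoef0 /zdeg /= subrr dvdz0.
pose P (m : int) := forall i j, w + d%:Z * m <= i - j < w + d%:Z * (m + 1) -> zcoef h (i, j) = 0.
suff allP m : P m.
    apply: (allP ((i - j - w) %/ d%:Z)%Z); have d1 : d%:Z != 0 by lia.
  have := divz_eq (i - j - w) d%:Z; have := modz_ge0 (i - j - w) d1.
  have : ((i - j - w) %% d%:Z)%Z < d%:Z by apply: ltz_pmod; lia.
  by rewrite mulrDr mulr1 [d%:Z * _]mulrC; lia.
have step m' : P m' -> P (m' + 1).
  move=> IH i' j' b.
  pose n := i' - j' - d%:Z; pose i0 := i' - c - k * n.
  have := shift_zcoef i0 (i0 - n) sh; rewrite [RHS]IH; last by rewrite /n; lia.
  by move=> <-; rewrite /i0 /n; congr (zcoef h (_, _)); ring.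
have stepN m' : P (m' + 1) -> P m'.
  move=> IH i' j' b; rewrite -(shift_zcoef i' j' sh); apply: IH; lia.
elim/int_ind: m => [|m IH|m IH].
- by move=> i' j'; rewrite mulr0 addr0 add0r mulr1; apply: base.
- by rewrite -addn1 PoszD; apply: step.
- by apply: stepN; rewrite -[- m.+1%:Z]/(Negz m) NegzE; have -> : - m.+1%:Z + 1 = - m%:Z by lia.
Qed.

(* A geometric series; the inverse inherits the grading of H. *)
Lemma inverse_exists l H : {morph l : u v / u + v} -> pure l 9 0 H -> head H = 1 ->
  exists2 G, pure l 9 0 G & G * H = 1.
Proof.
move=> lD pH h1; pose u := 1 - H.
have pu : pure l 9 0 u by apply: pureB => //; apply: pure1.
have vu : vanish 0 1 u by apply: vanish1_head; rewrite -headE rmorphB rmorph1 /= h1 subrr.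
have vuX n : vanish 0 n (u ^+ n).
  elim: n => [|n IH]; first exact: vanish_any.
  by rewrite exprSr -addn1; apply: vanishM.
pose S N := \sum_(k < N) u ^+ k.
have SE N N' : (N <= N')%N -> vanish 0 N (S N' - S N).
  move=> /subnK <-; elim: (N' - N)%N => [|m IH]; first by rewrite subrr => w _; rewrite zcoef0.
  rewrite addSn /S big_ord_recr /= addrAC; apply: vanishD => //.
  by apply: vanish_le (vuX _); rewrite leq_addl.
(* Since [u] has order at least 1, the coefficient of s^i t^j no longer changes after i + j + 1
   terms. *)
pose G := mkbis (fun i j => bcoef (S (i + j).+1) i j).
have GE N : vanish 0 N (G - S N).
  move=> [w1 w2] dw; rewrite dvd0z zcoefB.
  have [n|n] := boolP ((w1 < 0) || (w2 < 0)); first by rewrite !zcoef_neg ?subrr.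
  case: w1 w2 dw n => [i|i] [j|j] //= dw _.
  have lt_ijN : ((i + j).+1 <= N)%N by move: dw; rewrite -PoszD ltz_nat.
  have eG : zcoef G (Posz i, Posz j) = zcoef (S (i + j).+1) (Posz i, Posz j) by [].
  rewrite eG (vanish_zcoef (SE _ _ lt_ijN)) ?subrr //=.
  by rewrite -PoszD ltz_nat.
exists G.
  move=> [[i|i] [j|j]] //; rewrite /zcoef /=; set N := (i + j).+1 => nz.
  suff /(_ (Posz i, Posz j)) : pure l 9 0 (S N) by apply.
  elim/big_ind: (S N) => [|x y|k _]; [exact: pure0|exact: pureD|].
  by rewrite -[0](mul0r k%:Z); apply: pureX.
apply/eqP; rewrite -subr_eq0; apply/eqP; apply: vanish_eq0 => N.
have -> : G * H - 1 = (G - S N) * H - u ^+ N.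
  have -> : u ^+ N = 1 + (u - 1) * S N by rewrite /S -subrX1 addrC subrK.
  by rewrite /u; ring.
by apply: vanishD; [apply: vanishMr | apply: vanishN].
Qed.

(** * Theta functions *)

(* The sum of z^n q^(n(n+1)/2); s^i t^j = z^n q^e for n = i - j and e = i, and
   i = n(n+1)/2 amounts to (i - j)^2 = i + j. *)
Definition theta : bis :=
  mkbis (fun i j => ((i%:Z - j%:Z) ^+ 2 == i%:Z + j%:Z)%:R).

Lemma zcoef_theta u : zcoef theta u = ((u.1 - u.2) ^+ 2 == u.1 + u.2)%:R.
Proof.
case: u => u1 u2; rewrite zcoef_mkbis /=.
case: ifP => pos; first by congr ((_ == _)%:R); [congr (_ ^+ 2)|]; lia.
(* With n = u1 - u2, the equation gives 2 u1 = n^2 + n and 2 u2 = n^2 - n, both non-negative. *)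
case: eqP => // e; exfalso; move: e; rewrite expr2; set n := u1 - u2 => e.
have n1 : 0 <= n * n + n by case: (ltrP n 0) => *; nia.
have n2 : 0 <= n * n - n by case: (ltrP n 0) => *; nia.
by move: pos n1 n2; rewrite e /n; lia.
Qed.

Lemma zcoef_phi3 f u : zcoef (phi3 f) u =
  if (3 %| u.1)%Z && (3 %| u.2)%Z then zcoef f ((u.1 %/ 3)%Z, (u.2 %/ 3)%Z) else 0.
Proof.
case: u => u1 u2; have [fg f0] := phi3_transports f => /=.
case: ifPn => d.
  rewrite -fg addr0 /lin /=; congr (zcoef _ (_, _)); lia.
by rewrite f0 // => -[v1 v2]; rewrite addr0 /lin /= => -[e1 e2]; move: d; rewrite e1 e2; lia.
Qed.

Lemma zcoef_chi f u : zcoef (chi f) u =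
  if (3 %| u.1 + u.2)%Z
  then zcoef f (((2 * u.1 - u.2) %/ 3)%Z, ((2 * u.2 - u.1) %/ 3)%Z) else 0.
Proof.
case: u => u1 u2; have [fg f0] := chi_transports f => /=.
case: ifPn => d.
  rewrite -fg addr0 /lin /=; congr (zcoef _ (_, _)); lia.
by rewrite f0 // => -[v1 v2]; rewrite addr0 /lin /= => -[e1 e2]; move: d; rewrite e1 e2; lia.
Qed.

Lemma zcoef_swap f u : zcoef (swap f) u = zcoef f (u.2, u.1).
Proof.
case: u => u1 u2; have [fg _] := swap_transports f.
by rewrite -fg addr0 /lin /=; congr (zcoef _ (_, _)); lia.
Qed.

(** The sections T_c of theta and X_c of X; [phi3] replaces z and q by their cubes. *)
Definition theta3 (c : int) : bis := part zdeg 3 c theta.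
Definition theta9 (c : int) : bis := phi3 (theta3 c).

Lemma mod3_cases (n : int) : exists k, [\/ n = 3 * k, n = 3 * k + 1 | n = 3 * k + 2].
Proof.
exists (n %/ 3)%Z.
have [h|[h|h]] : (n %% 3)%Z = 0 \/ (n %% 3)%Z = 1 \/ (n %% 3)%Z = 2 by lia.
- by constructor 1; lia.
- by constructor 2; lia.
- by constructor 3; lia.
Qed.

Lemma zcoef_theta3 c u : zcoef (theta3 c) u =
  ((3 %| u.1 - u.2 - c)%Z && ((u.1 - u.2) ^+ 2 == u.1 + u.2))%:R.
Proof. by rewrite zcoef_part zcoef_theta; case: ifP. Qed.

Lemma sqr_eq3M (n m : int) : n ^+ 2 = 3 * m -> exists2 k, n = 3 * k & m = 3 * (k * k).
Proof.
have [k [->|->|->]] := mod3_cases n; rewrite expr2 => e; [by exists k; lia | lia | lia].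
Qed.

Lemma zcoef_theta9 c u : zcoef (theta9 c) u =
  ((9 %| u.1 - u.2 - 3 * c)%Z && ((u.1 - u.2) ^+ 2 == 3 * (u.1 + u.2)))%:R.
Proof.
case: u => u1 u2; rewrite zcoef_phi3 /=; case: ifPn => d.
  rewrite zcoef_theta3 /=; congr (_%:R); congr (nat_of_bool (_ && _)); first by apply/idP/idP; lia.
  by rewrite !expr2; apply/eqP/eqP; nia.
case: andP => // -[_ /eqP /sqr_eq3M [k e1 e2]]; case/negP: d; lia.
Qed.

Lemma zcoef_phi3_theta u : zcoef (phi3 theta) u = ((u.1 - u.2) ^+ 2 == 3 * (u.1 + u.2))%:R.
Proof.
case: u => u1 u2; rewrite zcoef_phi3 /=; case: ifPn => d.
  rewrite zcoef_theta /=; congr (nat_of_bool _)%:R.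
  by rewrite !expr2; apply/eqP/eqP; nia.
case: eqP => // /sqr_eq3M [k e1 e2]; case/negP: d; lia.
Qed.

(** In the variables z and q, [chi] is q -> q^3, z -> z/q, so [chi theta] is the series U, the sum
    of z^n q^(n(3n+1)/2). *)
Lemma zcoef_chi_theta u : zcoef (chi theta) u = (3 * (u.1 - u.2) ^+ 2 == u.1 + u.2)%:R.
Proof.
case: u => u1 u2; rewrite zcoef_chi /=; case: ifPn => d.
  rewrite zcoef_theta /=; congr (nat_of_bool _)%:R.
  have -> : ((2 * u1 - u2) %/ 3)%Z - ((2 * u2 - u1) %/ 3)%Z = u1 - u2 by lia.
  by apply/eqP/eqP; lia.
case: eqP => // e; case/negP: d; lia.
Qed.

Lemma theta3_period c : theta3 (c + 3) = theta3 c.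
Proof.
apply: zcoefP => -[u1 u2]; rewrite !zcoef_theta3 /=; congr (nat_of_bool (_ && _))%:R.
by apply/idP/idP; lia.
Qed.

Lemma theta9_period c : theta9 (c + 3) = theta9 c.
Proof. by rewrite /theta9 theta3_period. Qed.

Lemma pure_theta3 c : pure zdeg 3 c (theta3 c).
Proof. exact: pure_part. Qed.

Lemma pure_phi3 l m r f : {morph l : u v / u + v} ->
  pure l m r f -> pure l (3 * m) (3 * r) (phi3 f).
Proof.
move=> lD pf [u1 u2]; rewrite zcoef_phi3 /=; case: ifP => // d /pf dl.
have -> : (u1, u2) = ((u1 %/ 3)%Z, (u2 %/ 3)%Z) + ((u1 %/ 3)%Z, (u2 %/ 3)%Z)
    + ((u1 %/ 3)%Z, (u2 %/ 3)%Z) :> (int * int)%type by congr pair => /=; lia.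
rewrite !lD; move: (l _) dl => x dl.
have -> : x + x + x - 3 * r = 3 * (x - r) by ring.
by rewrite dvdz_mul2l.
Qed.

Lemma pure_theta9 c : pure zdeg 9 (3 * c) (theta9 c).
Proof. by have := pure_phi3 zdegD (@pure_theta3 c); rewrite [3 * 3](_ : _ = 9). Qed.

Lemma shift_theta3 c : shift 1 1 1 (theta3 (c + 1)) (theta3 c).
Proof.
apply: shiftP => i j; rewrite !zcoef_theta3 /=; congr (nat_of_bool (_ && _))%:R.
  by apply/idP/idP; lia.
by rewrite !expr2; apply/eqP/eqP; lia.
Qed.

Lemma shift_theta : shift 1 1 1 theta theta.
Proof.
apply: shiftP => i j; rewrite !zcoef_theta /=; congr (nat_of_bool _)%:R.
by rewrite !expr2; apply/eqP/eqP; lia.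
Qed.

Lemma shift3_theta3 c : shift 3 3 6 (theta3 c) (theta3 c).
Proof.
apply: shiftP => i j; rewrite !zcoef_theta3 /=; congr (nat_of_bool (_ && _))%:R.
  by apply/idP/idP; lia.
by rewrite !expr2; apply/eqP/eqP; lia.
Qed.

Lemma shift_theta9 c : shift 1 3 3 (theta9 (c + 1)) (theta9 c).
Proof.
apply: shiftP => i j; rewrite !zcoef_theta9 /=; congr (nat_of_bool (_ && _))%:R.
  by apply/idP/idP; lia.
by rewrite !expr2; apply/eqP/eqP; lia.
Qed.

Lemma shift_phi3_theta : shift 1 3 3 (phi3 theta) (phi3 theta).
Proof.
apply: shiftP => i j; rewrite !zcoef_phi3_theta /=; congr (nat_of_bool _)%:R.
by rewrite !expr2; apply/eqP/eqP; lia.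
Qed.

Lemma shift3_chi_theta : shift 3 1 2 (chi theta) (chi theta).
Proof.
apply: shiftP => i j; rewrite !zcoef_chi_theta /=; congr (nat_of_bool _)%:R.
by rewrite !expr2; apply/eqP/eqP; lia.
Qed.

(** For n = 3m the exponent n(n+1)/2 of theta is three times m(3m+1)/2, the exponent in U. Hence
    identities for U carry over to T0. *)
Lemma phi3_chi_theta : phi3 (chi theta) = theta3 0.
Proof.
apply: zcoefP => -[u1 u2]; rewrite zcoef_phi3 zcoef_theta3 /=.
case: ifPn => d.
  rewrite zcoef_chi_theta /=; congr (nat_of_bool _)%:R.
  have -> : (3 %| u1 - u2 - 0)%Z by lia.
  by rewrite !expr2; apply/eqP/eqP; nia.
case: andP => // -[d0 /eqP]; rewrite expr2 => e; case/negP: d.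
have [k ek] : exists k, u1 - u2 = 3 * k by exists ((u1 - u2) %/ 3)%Z; lia.
by move: e; rewrite ek; lia.
Qed.

Lemma chi_phi3 f : chi (phi3 f) = phi3 (chi f).
Proof.
apply: zcoefP => -[u1 u2]; rewrite zcoef_chi !zcoef_phi3 /=.
case: (boolP ((3 %| u1)%Z && (3 %| u2)%Z)) => d.
  rewrite zcoef_chi /= ifT; last by lia.
  have -> : (3 %| ((2 * u1 - u2) %/ 3)%Z)%Z && (3 %| ((2 * u2 - u1) %/ 3)%Z)%Z
     = (3 %| (u1 %/ 3)%Z + (u2 %/ 3)%Z)%Z by apply/idP/idP; lia.
  by case: ifP => // d'; congr (zcoef _ (_, _)); lia.
by case: ifP => // d'; rewrite ifF //; lia.
Qed.

Lemma swap_chi_theta : swap (chi theta) = chi theta.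
Proof.
apply: zcoefP => -[u1 u2]; rewrite zcoef_swap !zcoef_chi_theta /=.
by congr (nat_of_bool _)%:R; rewrite !expr2; apply/eqP/eqP; lia.
Qed.

Lemma zcoef_offdiag f v1 v2 : pure zdeg 0 0 f -> v1 != v2 -> zcoef f (v1, v2) = 0.
Proof.
move=> pf nv; apply/eqP; apply: contraNT nv => /pf.
by rewrite dvd0z /zdeg /= subr0 subr_eq0.
Qed.

(** Both substitutions send q to q^3 and differ only in their effect on z. *)
Lemma chi_qseries f : pure zdeg 0 0 f -> chi f = phi3 f.
Proof.
move=> pf; apply: zcoefP => -[u1 u2]; rewrite zcoef_chi zcoef_phi3 /=.
have z v1 v2 := @zcoef_offdiag f v1 v2 pf.
case: (eqVneq u1 u2) => [->|nu].
  have -> : (3 %| u2 + u2)%Z = (3 %| u2)%Z && (3 %| u2)%Z by apply/idP/idP; lia.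
  by case: ifP => // d; congr (zcoef _ (_, _)); lia.
have -> : (if (3 %| u1 + u2)%Z then zcoef f (((2 * u1 - u2) %/ 3)%Z, ((2 * u2 - u1) %/ 3)%Z)
  else 0) = 0 by case: ifPn => // d; rewrite z //; lia.
by case: ifPn => // d; rewrite z //; lia.
Qed.

Lemma pure_chi m r f : pure zdeg m r f -> pure zdeg m r (chi f).
Proof.
move=> pf [u1 u2]; rewrite zcoef_chi /=; case: ifP => // d /pf.
by rewrite /zdeg /=; have -> : ((2 * u1 - u2) %/ 3)%Z - ((2 * u2 - u1) %/ 3)%Z = u1 - u2 by lia.
Qed.

Lemma part_theta0 : part zdeg 0 0 theta = 1.
Proof.
apply: zcoefP => -[u1 u2]; rewrite zcoef_part zcoef_theta zcoef1 dvd0z /zdeg /= xpair_eqE.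
case: eqP => e1; [congr (nat_of_bool _)%:R | by case: andP => // -[/eqP e2 /eqP e3]; lia].
rewrite expr2; apply/eqP/andP => [e|[/eqP e2 /eqP e3]]; last by nia.
have e0 : u1 - u2 = 0 by lia.
by rewrite e0 in e; split; apply/eqP; lia.
Qed.

Lemma part_theta3 c : c = 0 \/ c = 1 \/ c = -1 ->
  part zdeg 0 c (theta3 c) = mono (c == 1) (c == -1).
Proof.
move=> hc; apply: zcoefP => -[u1 u2].
rewrite zcoef_part zcoef_theta3 zcoef_mono dvd0z /zdeg /= xpair_eqE.
case: eqP => e1; last by case: andP => // -[/eqP e2 /eqP e3]; lia.
congr (nat_of_bool _)%:R; have -> : (3 %| u1 - u2 - c)%Z by lia.
have e0 : u1 - u2 = c by lia.
rewrite e0 /=; apply/eqP/andP => [e|[/eqP e2 /eqP e3]].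
  by case: hc e e0 => [->|[->|->]] /= e e0; split; apply/eqP; lia.
by move: e0; rewrite e2 e3; case: hc => [->|[->|->]].
Qed.

Lemma part_phi3_theta : part zdeg 0 0 (phi3 theta) = 1.
Proof.
apply: zcoefP => -[u1 u2]; rewrite zcoef_part zcoef_phi3_theta zcoef1 dvd0z /zdeg /= xpair_eqE.
case: eqP => e1; [congr (nat_of_bool _)%:R | by case: andP => // -[/eqP e2 /eqP e3]; lia].
have e0 : u1 - u2 = 0 by lia.
rewrite e0; apply/eqP/andP => [e|[/eqP e2 /eqP e3]]; last by lia.
by split; apply/eqP; lia.
Qed.

Lemma theta_decomp : theta = theta3 0 + theta3 1 + theta3 2.
Proof. exact: part3_decomp. Qed.

(** Modulo 3, n(n+1)/2 is 1 when n is 1 and 0 otherwise. *)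
Lemma qpure_theta3 c : c = 0 \/ c = 1 \/ c = 2 -> pure qdeg 3 (c == 1)%:Z (theta3 c).
Proof.
move=> hc [u1 u2]; rewrite zcoef_theta3 /qdeg /= => nz.
have /andP [d /eqP] : (3 %| u1 - u2 - c)%Z && ((u1 - u2) ^+ 2 == u1 + u2).
  by move: nz; case: (_ && _).
have [k ek] : exists k, u1 - u2 = 3 * k + c by exists ((u1 - u2 - c) %/ 3)%Z; lia.
by rewrite ek expr2; case: hc ek => [->|[->|->]] /= ek e; lia.
Qed.

(** * Cubes of theta functions *)

(* The coefficient of z in f, divided by s = z q. *)
Definition scoef1 (f : bis) : bis :=
  mkbis (fun i j => if i == j then bcoef f i.+1 j else 0).

Lemma zcoef_scoef1 f u : zcoef (scoef1 f) u =
  if u.1 == u.2 then zcoef f (u.1 + 1, u.2) else 0.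
Proof.
case: u => [[i|i] [j|j]]; rewrite /zcoef //=; first by rewrite eqz_nat addn1.
by case: ifP => //; case: i => [|i]; rewrite /= ?subn1.
Qed.

Lemma pure_scoef1 f : pure zdeg 0 0 (scoef1 f).
Proof.
move=> u; rewrite zcoef_scoef1; case: ifP => [/eqP e _|_]; last by rewrite eqxx.
by rewrite /zdeg e subrr dvd0z.
Qed.

Lemma scoef1P f : mono 1 0 * scoef1 f = part zdeg 0 1 f.
Proof.
apply: zcoefP => -[u1 u2]; rewrite zcoef_monoM zcoef_scoef1 zcoef_part /zdeg dvd0z /=.
by congr (if _ then zcoef _ (_, _) else _); [apply/eqP/eqP | |]; lia.
Qed.

Lemma pure_phi3_qseries f : pure zdeg 0 0 f -> pure zdeg 0 0 (phi3 f).
Proof. by move/(pure_phi3 zdegD); rewrite !mulr0. Qed.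

Lemma swap_qseries f : pure zdeg 0 0 f -> swap f = f.
Proof.
move=> pf; apply: zcoefP => -[u1 u2]; rewrite zcoef_swap /=.
case: (eqVneq u1 u2) => [->//|nu].
have z v1 v2 := @zcoef_offdiag f v1 v2 pf.
by rewrite !z // eq_sym.
Qed.

Lemma part_swap n f : part zdeg 0 (- n) (swap f) = swap (part zdeg 0 n f).
Proof.
apply: zcoefP => -[u1 u2]; rewrite zcoef_swap !zcoef_part zcoef_swap /zdeg !dvd0z /=.
by congr (if _ then _ else _); apply/eqP/eqP; lia.
Qed.

Lemma shift_cube k d c h g : shift k d c h g -> shift k (3 * d) (3 * c) (h ^+ 3) (g ^+ 3).
Proof.
move=> s; have := shiftM s (shiftM s s).
have e3 x : x + (x + x) = 3 * x :> int by ring.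
by rewrite !e3 -!expr2 -!exprS.
Qed.

Lemma part_qseriesM n d f : pure zdeg 0 0 d -> part zdeg 0 n (d * f) = d * part zdeg 0 n f.
Proof. by move=> pd; apply: part_mul => //; apply: zdegD. Qed.

Lemma part_theta3_neq n c : ~~ (3 %| n - c)%Z -> part zdeg 0 n (theta3 c) = 0.
Proof. by move=> nd; apply: (part_eq0 (@pure_theta3 c)). Qed.

Local Notation T0 := (theta3 0).
Local Notation T1 := (theta3 1).
Local Notation T2 := (theta3 2).
Local Notation X0 := (theta9 0).
Local Notation X1 := (theta9 1).
Local Notation X2 := (theta9 2).

(* In terms of the Borwein functions a(q), the theta series of A_2, and
   c(q) = 3 q^(1/3) (1 + q + 2 q^2 + ...): cp = a(q^3), cr = c(q^3), ca = a(q^9),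
   cc = c(q^9), cx = c(q^3)/3. *)
Definition cp : bis := part zdeg 0 0 (chi theta ^+ 3).
Definition cr : bis := scoef1 (chi theta ^+ 3).
Definition ca : bis := phi3 cp.
Definition cc : bis := phi3 cr.
Definition cx : bis := part zdeg 0 0 (T0 * T1 * T2).

Lemma pure_cp : pure zdeg 0 0 cp. Proof. exact: pure_part. Qed.
Lemma pure_cr : pure zdeg 0 0 cr. Proof. exact: pure_scoef1. Qed.
Lemma pure_cx : pure zdeg 0 0 cx. Proof. exact: pure_part. Qed.
Lemma pure_ca : pure zdeg 0 0 ca. Proof. exact: pure_phi3_qseries pure_cp. Qed.
Lemma pure_cc : pure zdeg 0 0 cc. Proof. exact: pure_phi3_qseries pure_cr. Qed.

(** Both sides satisfy the same equation of order 3 under z -> z q^3, so the coefficients of z^-1, 1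
    and z decide. Those of 1 and z define [cp] and [cr]; the symmetry [swap], that is z -> 1/(z q),
    reduces z^-1 to z. *)
Lemma chi_theta_cube : chi theta ^+ 3 = cp * T0 + cr * T1 + cr * T2.
Proof.
apply/eqP; rewrite -subr_eq0; apply/eqP.
apply: (@theta_unique 3 3 6 (-1)) => //.
  apply: shiftD; first exact: shift_cube shift3_chi_theta.
  have sM := shiftMl _ (shift3_theta3 _).
  by apply: shiftN; do 2?[apply: shiftD]; apply: sM; [exact: pure_cp | exact: pure_cr..].
move=> n hn; have [->|[->|->]] : n = -1 \/ n = 0 \/ n = 1 by lia.
- rewrite raddfB !raddfD /= !(@part_qseriesM _ _ _ pure_cp, @part_qseriesM _ _ _ pure_cr).
  have -> : part zdeg 0 (-1) T2 = mono 0 1.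
    by have := theta3_period (-1); rewrite [-1 + 3](_ : _ = 2) // => ->; rewrite part_theta3 //; right; right.
  rewrite !part_theta3_neq // !mulr0 !add0r.
  rewrite -swap_chi_theta -rmorphXn /= part_swap -scoef1P rmorphM /=.
  have -> : swap (mono 1 0) = mono 0 1.
    by apply: zcoefP => u; rewrite zcoef_swap !zcoef_mono !xpair_eqE andbC.
  by rewrite (swap_qseries (@pure_scoef1 _)) mulrC subrr.
- rewrite raddfB !raddfD /= !(@part_qseriesM _ _ _ pure_cp, @part_qseriesM _ _ _ pure_cr).
  have -> : part zdeg 0 0 T0 = 1 by rewrite part_theta3 ?mono00 //; left.
  by rewrite !part_theta3_neq // !mulr0 !addr0 mulr1 subrr.
- rewrite raddfB !raddfD /= !(@part_qseriesM _ _ _ pure_cp, @part_qseriesM _ _ _ pure_cr).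
  have -> : part zdeg 0 1 T1 = mono 1 0 by rewrite part_theta3 //; right; left.
  by rewrite !part_theta3_neq // !mulr0 addr0 add0r -scoef1P mulrC subrr.
Qed.

Lemma theta3_0_cube : T0 ^+ 3 = ca * X0 + cc * (X1 + X2).
Proof.
by rewrite -phi3_chi_theta -rmorphXn chi_theta_cube !rmorphD !rmorphM /= mulrDr addrA.
Qed.

Lemma theta9_3 : theta9 3 = X0. Proof. exact: theta9_period 0. Qed.
Lemma theta3_3 : theta3 3 = T0. Proof. exact: theta3_period 0. Qed.

Lemma shift_theta9_2 : shift 1 3 3 X0 X2.
Proof. by rewrite -theta9_3; exact: (shift_theta9 2). Qed.

(** The shift z -> z q permutes the T_c and the X_c cyclically with matching factors, and fixes
    series in q; it carries the identity for T0 to T1, and then to T2. *)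
Lemma theta3_1_cube : T1 ^+ 3 = ca * X1 + cc * (X2 + X0).
Proof.
apply: (shift_uniq (k := 1) (d := 3) (c := 3) (g := T0 ^+ 3)).
  exact: shift_cube (shift_theta3 0).
rewrite theta3_0_cube; apply: shiftD.
  exact: shiftMl pure_ca (shift_theta9 0).
by apply: shiftMl pure_cc _; apply: shiftD (shift_theta9 1) shift_theta9_2.
Qed.

Lemma theta3_2_cube : T2 ^+ 3 = ca * X2 + cc * (X0 + X1).
Proof.
apply: (shift_uniq (k := 1) (d := 3) (c := 3) (g := T1 ^+ 3)).
  exact: shift_cube (shift_theta3 1).
rewrite theta3_1_cube; apply: shiftD.
  exact: shiftMl pure_ca (shift_theta9 1).
by apply: shiftMl pure_cc _; apply: shiftD shift_theta9_2 (shift_theta9 0).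
Qed.

Lemma phi3_theta_decomp : phi3 theta = X0 + X1 + X2.
Proof. by rewrite {1}theta_decomp !rmorphD. Qed.

(** The cyclic permutation of the T_c under z -> z q gives the product the functional equation of X,
    of order 3. Both sides only contain powers of z^3, so a single coefficient has to be
    compared. *)
Lemma theta3_prod : T0 * T1 * T2 = cx * phi3 theta.
Proof.
apply/eqP; rewrite -subr_eq0; apply/eqP.
apply: (@theta_unique 1 3 3 0) => //.
  apply: shiftD.
    have := shiftM (shiftM (shift_theta3 0) (shift_theta3 1)) (shift_theta3 2).
    by rewrite -[0 + 1]/(1 : int) -[1 + 1]/(2 : int) -[2 + 1]/(3 : int) theta3_3 mulrAC [T1 * _]mulrC.
  by apply: shiftN; apply: shiftMl pure_cx shift_phi3_theta.
have pT : pure zdeg 3 0 (T0 * T1 * T2).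
  have := pureM zdegD (pureM zdegD (@pure_theta3 0) (@pure_theta3 1)) (@pure_theta3 2).
  by move/pure_mod; apply.
have pX : pure zdeg 3 0 (phi3 theta).
  have t : pure zdeg 1 0 theta by move=> u _; apply: dvd1z.
  by have := pure_phi3 zdegD t; rewrite mulr0 mulr1.
move=> n hn; have [->|hn1] : n = 0 \/ (n = 1 \/ n = 2) by lia.
  by rewrite raddfB /= (@part_qseriesM _ _ _ pure_cx) part_phi3_theta mulr1 subrr.
rewrite raddfB /= (@part_qseriesM _ _ _ pure_cx).
by rewrite (part_eq0 pT) ?(part_eq0 pX) ?mulr0 ?subrr //; case: hn1 => ->.
Qed.

Lemma zcoef_neq0 f u : zcoef f u != 0 -> f <> 0.
Proof. by move=> nz e; move: nz; rewrite e zcoef0 eqxx. Qed.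

Lemma theta3_0_neq0 : T0 <> 0.
Proof. by apply: (@zcoef_neq0 _ (0, 0)); rewrite zcoef_theta3. Qed.
Lemma theta3_1_neq0 : T1 <> 0.
Proof. by apply: (@zcoef_neq0 _ (1, 0)); rewrite zcoef_theta3. Qed.
Lemma theta3_2_neq0 : T2 <> 0.
Proof. by apply: (@zcoef_neq0 _ (0, 1)); rewrite zcoef_theta3. Qed.
Lemma theta9_0_neq0 : X0 <> 0.
Proof. by apply: (@zcoef_neq0 _ (0, 0)); rewrite zcoef_theta9. Qed.
Lemma theta9_1_neq0 : X1 <> 0.
Proof. by apply: (@zcoef_neq0 _ (3, 0)); rewrite zcoef_theta9. Qed.

Lemma cx_neq0 : cx <> 0.
Proof.
move=> e; have := theta3_prod; rewrite e mul0r.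
by case/bis_mulf_eq0 => [/bis_mulf_eq0 []|] //; [exact: theta3_0_neq0|exact: theta3_1_neq0|exact: theta3_2_neq0].
Qed.

Lemma chi_phi3_theta : chi (phi3 theta) = T0.
Proof. by rewrite chi_phi3 phi3_chi_theta. Qed.

Arguments shead : simpl never.

Lemma pureM0 l m r f g : {morph l : u v / u + v} -> pure l m 0 f -> pure l m r g ->
  pure l m r (f * g).
Proof. by move=> lD pf pg; have := pureM lD pf pg; rewrite add0r. Qed.

Lemma pureX0 l m f n : {morph l : u v / u + v} -> pure l m 0 f -> pure l m 0 (f ^+ n).
Proof. by move=> lD pf; have := pureX lD (n := n) pf; rewrite mul0r. Qed.

Lemma pure_nat l m (n : nat) : {morph l : u v / u + v} -> pure l m 0 n%:R.
Proof. by move=> lD; apply: pureMn; apply: pure1. Qed.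

Ltac pure0 lD :=
  match goal with
  | |- pure _ _ _ (_ + _) => apply: pureD; pure0 lD
  | |- pure _ _ _ (- _) => apply: pureN; pure0 lD
  | |- pure _ _ _ (_ * _) => apply: (@pureM0 _ _ _ _ _ lD); pure0 lD
  | |- pure _ _ _ (_ ^+ _) => apply: (@pureX0 _ _ _ _ lD); pure0 lD
  | |- pure _ _ _ 1 => exact: (@pure1 _ lD _)
  | |- pure _ _ _ (_%:R) => exact: (@pure_nat _ _ _ lD)
  | |- _ => try assumption
  end.

Lemma pureM_mod l m r1 r2 r f g : {morph l : u v / u + v} ->
  pure l m r1 f -> pure l m r2 g -> (m %| r1 + r2 - r)%Z -> pure l m r (f * g).
Proof. by move=> lD pf pg d; apply: pure_mod d; apply: pureM. Qed.

Lemma pure_qseries m f : pure zdeg 0 0 f -> pure zdeg m 0 f.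
Proof. by move=> pf; apply: pure_dvd pf _; apply: dvdz0. Qed.

Section CubeSections.
Variables f0 f1 f2 : bis.
Hypothesis p0 : pure zdeg 3 0 f0.
Hypothesis p1 : pure zdeg 3 1 f1.
Hypothesis p2 : pure zdeg 3 2 f2.

(** These are the sections of (f0 + f1 + f2)^3 by z-degree modulo 3. *)
Definition cube0 := f0 ^+ 3 + f1 ^+ 3 + f2 ^+ 3 + 6 * (f0 * f1 * f2).
Definition cube1 := 3 * (f0 ^+ 2 * f1 + f1 ^+ 2 * f2 + f2 ^+ 2 * f0).
Definition cube2 := 3 * (f0 ^+ 2 * f2 + f1 ^+ 2 * f0 + f2 ^+ 2 * f1).

Lemma cubeE : (f0 + f1 + f2) ^+ 3 = cube0 + cube1 + cube2.
Proof. by rewrite /cube0 /cube1 /cube2; ring. Qed.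

Let pX m r r' f n : pure zdeg m r f -> (m %| r * n%:Z - r')%Z -> pure zdeg m r' (f ^+ n).
Proof. by move=> pf d; apply: pure_mod d; apply: pureX => //; apply: zdegD. Qed.
Let pM m r1 r2 r f g := @pureM_mod zdeg m r1 r2 r f g zdegD.

Lemma pure_cube0 : pure zdeg 3 0 cube0.
Proof.
have q0 : pure zdeg 3 0 (f0 ^+ 3) by apply: pX p0 _.
have q1 : pure zdeg 3 0 (f1 ^+ 3) by apply: pX p1 _.
have q2 : pure zdeg 3 0 (f2 ^+ 3) by apply: pX p2 _.
have q01 : pure zdeg 3 1 (f0 * f1) by apply: pM p0 p1 _.
have q012 : pure zdeg 3 0 (f0 * f1 * f2) by apply: pM q01 p2 _.
have q6 : pure zdeg 3 0 (6 * (f0 * f1 * f2)) by apply: pM (@pure_nat zdeg 3 6 zdegD) q012 _.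
exact: pureD (pureD (pureD q0 q1) q2) q6.
Qed.

Lemma pure_cube1 : pure zdeg 3 1 cube1.
Proof.
have q0 : pure zdeg 3 0 (f0 ^+ 2) by apply: pX p0 _.
have q1 : pure zdeg 3 2 (f1 ^+ 2) by apply: pX p1 _.
have q2 : pure zdeg 3 1 (f2 ^+ 2) by apply: pX p2 _.
have r0 : pure zdeg 3 1 (f0 ^+ 2 * f1) by apply: pM q0 p1 _.
have r1 : pure zdeg 3 1 (f1 ^+ 2 * f2) by apply: pM q1 p2 _.
have r2 : pure zdeg 3 1 (f2 ^+ 2 * f0) by apply: pM q2 p0 _.
have s : pure zdeg 3 1 (f0 ^+ 2 * f1 + f1 ^+ 2 * f2 + f2 ^+ 2 * f0).
  by do 2?[apply: pureD => //].
by apply: pM (@pure_nat zdeg 3 3 zdegD) s _.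
Qed.

Lemma pure_cube2 : pure zdeg 3 2 cube2.
Proof.
have q0 : pure zdeg 3 0 (f0 ^+ 2) by apply: pX p0 _.
have q1 : pure zdeg 3 2 (f1 ^+ 2) by apply: pX p1 _.
have q2 : pure zdeg 3 1 (f2 ^+ 2) by apply: pX p2 _.
have r0 : pure zdeg 3 2 (f0 ^+ 2 * f2) by apply: pM q0 p2 _.
have r1 : pure zdeg 3 2 (f1 ^+ 2 * f0) by apply: pM q1 p0 _.
have r2 : pure zdeg 3 2 (f2 ^+ 2 * f1) by apply: pM q2 p1 _.
have s : pure zdeg 3 2 (f0 ^+ 2 * f2 + f1 ^+ 2 * f0 + f2 ^+ 2 * f1).
  by do 2?[apply: pureD => //].
by apply: pM (@pure_nat zdeg 3 3 zdegD) s _.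
Qed.
End CubeSections.

Lemma part_sum3_all l m r0 r1 r2 a b c :
  pure l m r0 a -> pure l m r1 b -> pure l m r2 c ->
  ~~ (m %| r0 - r1)%Z -> ~~ (m %| r0 - r2)%Z -> ~~ (m %| r1 - r2)%Z ->
  [/\ part l m r0 (a + b + c) = a, part l m r1 (a + b + c) = b
    & part l m r2 (a + b + c) = c].
Proof.
have sym (x y : int) : ~~ (m %| x - y)%Z -> ~~ (m %| y - x)%Z.
  by apply: contra; rewrite -(opprB y x) rpredN.
move=> pa pb pc n01 n02 n12; split.
- exact: part_sum3 pa pb pc _ _.
- by rewrite [a + b]addrC; apply: part_sum3 pb pa pc (sym _ _ _) _.
- by rewrite addrC addrA; apply: part_sum3 pc pa pb (sym _ _ _) (sym _ _ _).
Qed.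

Lemma pure_sum3_inj l m r0 r1 r2 a b c a' b' c' :
  pure l m r0 a -> pure l m r1 b -> pure l m r2 c ->
  pure l m r0 a' -> pure l m r1 b' -> pure l m r2 c' ->
  ~~ (m %| r0 - r1)%Z -> ~~ (m %| r0 - r2)%Z -> ~~ (m %| r1 - r2)%Z ->
  a + b + c = a' + b' + c' -> [/\ a = a', b = b' & c = c'].
Proof.
move=> pa pb pc pa' pb' pc' n01 n02 n12 e.
have [ea eb ec] := part_sum3_all pa pb pc n01 n02 n12.
have [ea' eb' ec'] := part_sum3_all pa' pb' pc' n01 n02 n12.
by split; [rewrite -[LHS]ea e|rewrite -[LHS]eb e|rewrite -[LHS]ec e].
Qed.

Lemma theta3_cube_sum :
  T0 ^+ 3 + T1 ^+ 3 + T2 ^+ 3 = (ca + 2 * cc) * phi3 theta.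
Proof.
by rewrite theta3_0_cube theta3_1_cube theta3_2_cube phi3_theta_decomp; ring.
Qed.

(** As [chi] preserves the z-degree, the [chi T_c] are the sections of U; the sections of both sides
    of [chi_theta_cube] are compared. *)
Lemma chi_theta_sections :
  [/\ cube0 (chi T0) (chi T1) (chi T2) = cp * T0,
      cube1 (chi T0) (chi T1) (chi T2) = cr * T1
    & cube2 (chi T0) (chi T1) (chi T2) = cr * T2].
Proof.
have q0 := pure_chi (@pure_theta3 0).
have q1 := pure_chi (@pure_theta3 1).
have q2 := pure_chi (@pure_theta3 2).
apply: (@pure_sum3_inj zdeg 3 0 1 2) => //.
- exact: pure_cube0.
- exact: pure_cube1.
- exact: pure_cube2.
- exact: pureM0 zdegD (@pure_qseries 3 _ pure_cp) (@pure_theta3 0).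
- exact: pureM0 zdegD (@pure_qseries 3 _ pure_cr) (@pure_theta3 1).
- exact: pureM0 zdegD (@pure_qseries 3 _ pure_cr) (@pure_theta3 2).
- by rewrite -cubeE -chi_theta_cube theta_decomp !rmorphD.
Qed.

(** The section of degree 0 of U^3 is the image under [chi] of (ca + 2 cc + 6 cx) X, and chi X = T0
    cancels. *)
Lemma cp_dissection : cp = phi3 (ca + 2 * cc + 6 * cx).
Proof.
have [e0 _ _] := chi_theta_sections.
apply: (bis_mulfI theta3_0_neq0); rewrite [LHS]mulrC -e0.
have -> : cube0 (chi T0) (chi T1) (chi T2) = chi (cube0 T0 T1 T2).
  by rewrite /cube0 !(rmorphD, rmorphM, rmorphXn, rmorph_nat).
rewrite /cube0 theta3_cube_sum theta3_prod mulrA -mulrDl rmorphM /= chi_phi3_theta mulrC.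
congr (_ * _); apply: chi_qseries.
have pa := pure_ca; have pc := pure_cc; have px := pure_cx; pure0 zdegD.
Qed.

(* Compare the sections modulo 9 of (T0 T1 T2)^3 = (cx X)^3. *)
Lemma cx_cube : cc * (ca ^+ 2 + ca * cc + cc ^+ 2) = 3 * cx ^+ 3.
Proof.
pose W := X0 ^+ 2 * X1 + X1 ^+ 2 * X2 + X2 ^+ 2 * X0.
pose W' := X0 ^+ 2 * X2 + X1 ^+ 2 * X0 + X2 ^+ 2 * X1.
(* [R], [k * W] and [k * W'] are the sections of z-degree 0, 3 and 6 modulo 9 of the difference of
   the two sides. *)
pose k := cc * (ca ^+ 2 + ca * cc + cc ^+ 2) - 3 * cx ^+ 3.
pose k0 := ca * cc ^+ 2 - cx ^+ 3.
pose k1 := ca ^+ 3 + 3 * (ca * cc ^+ 2) + 2 * cc ^+ 3 - 6 * cx ^+ 3.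
pose R := k0 * (X0 ^+ 3 + X1 ^+ 3 + X2 ^+ 3) + k1 * (X0 * X1 * X2).
have e : R + k * W + k * W' = 0.
  transitivity (T0 ^+ 3 * T1 ^+ 3 * T2 ^+ 3 - (cx * phi3 theta) ^+ 3).
    rewrite theta3_0_cube theta3_1_cube theta3_2_cube phi3_theta_decomp.
    by rewrite /R /k /k0 /k1 /W /W'; ring.
  by rewrite -!exprMn theta3_prod subrr.
have pX m r r' f n : pure zdeg m r f -> (m %| r * n%:Z - r')%Z -> pure zdeg m r' (f ^+ n).
  by move=> pf d; apply: pure_mod d; apply: pureX => //; apply: zdegD.
have pM m r1 r2 r f g := @pureM_mod zdeg m r1 r2 r f g zdegD.
have p0 := @pure_theta9 0; have p1 := @pure_theta9 1; have p2 := @pure_theta9 2.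
have pa := @pure_qseries 9 _ pure_ca; have pc := @pure_qseries 9 _ pure_cc; have px := @pure_qseries 9 _ pure_cx.
have pM0 r f g := @pureM0 zdeg 9 r f g zdegD.
have pk : pure zdeg 9 0 k by rewrite /k; pure0 zdegD.
have pR : pure zdeg 9 0 R.
  have pk0 : pure zdeg 9 0 k0 by rewrite /k0; pure0 zdegD.
  have pk1 : pure zdeg 9 0 k1 by rewrite /k1; pure0 zdegD.
  apply: pureD; apply: pM0 => //.
    by do 2?[apply: pureD]; [apply: pX p0 _|apply: pX p1 _|apply: pX p2 _].
  have p01 : pure zdeg 9 3 (X0 * X1) by apply: pM p0 p1 _.
  by apply: pM p01 p2 _.
have s0 r : (9 %| 3 * 0 * 2 - r)%Z -> pure zdeg 9 r (X0 ^+ 2) by move=> d; apply: pX p0 d.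
have s1 r : (9 %| 3 * 1 * 2 - r)%Z -> pure zdeg 9 r (X1 ^+ 2) by move=> d; apply: pX p1 d.
have s2 r : (9 %| 3 * 2 * 2 - r)%Z -> pure zdeg 9 r (X2 ^+ 2) by move=> d; apply: pX p2 d.
have pW : pure zdeg 9 3 W.
  do 2?[apply: pureD].
  - by apply: pM (s0 0 isT) p1 _.
  - by apply: pM (s1 6 isT) p2 _.
  - by apply: pM (s2 3 isT) p0 _.
have pW' : pure zdeg 9 6 W'.
  do 2?[apply: pureD].
  - by apply: pM (s0 0 isT) p2 _.
  - by apply: pM (s1 6 isT) p0 _.
  - by apply: pM (s2 3 isT) p1 _.
have [_ kW _] := part_sum3_all pR (pM0 _ _ _ pk pW) (pM0 _ _ _ pk pW') isT isT isT.
have := kW; rewrite e raddf0 => /esym/bis_mulf_eq0 [|W0].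
  by move/eqP; rewrite subr_eq0 => /eqP.
(* It remains to exclude W = 0: at t = 0 the series X2 vanishes and W reduces to X0^2 X1, which is
   not zero. *)
have sX2 : shead X2 = 0.
  apply: series_eqP => i; have -> : scoef (shead X2) i = zcoef X2 (Posz i, Posz 0) by [].
  rewrite zcoef_theta9 /=; case: andP => // -[d /eqP]; rewrite expr2 => e2.
  exfalso; have : (i = 0 \/ i = 3)%N by nia.
  by case=> ei; move: d; rewrite ei.
have : shead W = 0 by rewrite W0.
rewrite /W !(rmorphD, rmorphM, rmorphXn) /= sX2 ?expr2 !mul0r !mulr0 !addr0.
have dom := @series_mulf_eq0 int _.
have domZ (x y : int) : x * y = 0 -> x = 0 \/ y = 0.
  by move/eqP; rewrite mulf_eq0 => /orP[] /eqP ->; [left|right].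
have n0 : shead X0 <> 0.
  move/(congr1 (fun f => scoef f 0%N)).
  by have -> : scoef (shead X0) 0 = zcoef X0 (Posz 0, Posz 0) by []; rewrite zcoef_theta9.
have n1 : shead X1 <> 0.
  move/(congr1 (fun f => scoef f 3%N)).
  by have -> : scoef (shead X1) 3 = zcoef X1 (Posz 3, Posz 0) by []; rewrite zcoef_theta9.
by case/(dom domZ) => // /(dom domZ) [].
Qed.

Lemma head_part_zdeg f : head (part zdeg 0 0 f) = head f.
Proof. by rewrite !headE zcoef_part. Qed.

Lemma head_phi3 f : head (phi3 f) = head f.
Proof. by rewrite !headE zcoef_phi3 /=. Qed.

Lemma head_cp : head cp = 1.
Proof. by rewrite head_part_zdeg rmorphXn /= headE zcoef_chi_theta. Qed.

Lemma head_cr : head cr = 0.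
Proof.
rewrite headE zcoef_scoef1 /=.
have -> : zcoef (chi theta ^+ 3) (0 + 1, 0) = scoef (shead (chi theta ^+ 3)) 1 by [].
have -> : shead (chi theta ^+ 3) = shead (chi theta) ^+ 3 by rewrite rmorphXn.
have -> : shead (chi theta) = 1.
  apply: series_eqP => i.
  have -> : scoef (shead (chi theta)) i = zcoef (chi theta) (Posz i, Posz 0) by [].
  rewrite zcoef_chi_theta /=; congr (nat_of_bool _)%:R.
  by rewrite expr2; apply/eqP/eqP; nia.
by rewrite expr1n.
Qed.

Lemma head_ca : head ca = 1. Proof. by rewrite head_phi3 head_cp. Qed.
Lemma head_cc : head cc = 0. Proof. by rewrite head_phi3 head_cr. Qed.

Lemma head_neq0 f : head f != 0 -> f <> 0.
Proof. by move=> h e; move: h; rewrite e raddf0 eqxx. Qed.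

Lemma cr_neq0 : cr <> 0.
Proof.
move=> e; have c0 : cc = 0 by rewrite /cc e raddf0.
have := cx_cube; rewrite c0 mul0r => /esym/bis_mulf_eq0 [|].
  by apply: head_neq0; rewrite rmorph_nat.
rewrite exprS expr2 => /bis_mulf_eq0 [|/bis_mulf_eq0 []]; exact: cx_neq0.
Qed.

(* The norm f0^3 + f1^3 + f2^3 - 3 f0 f1 f2 of the z-sections is
   multiplicative; apply it to U^3. *)
Lemma norm_relation : cr * (ca + 2 * cc) = 3 * (cp * cx).
Proof.
have [e0 e1 e2] := chi_theta_sections.
pose p' := ca + 2 * cc; pose B := chi (p' - 3 * cx).
have normU : chi T0 ^+ 3 + chi T1 ^+ 3 + chi T2 ^+ 3 - 3 * (chi T0 * chi T1 * chi T2) = B * T0.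
  rewrite -!rmorphXn -!rmorphM -(rmorph_nat chi) -!rmorphD -rmorphM -rmorphB /=.
  by rewrite theta3_cube_sum theta3_prod mulrA -mulrBl rmorphM /= chi_phi3_theta.
have e : cp ^+ 3 * T0 ^+ 3 + cr ^+ 3 * (T1 ^+ 3 + T2 ^+ 3) - 3 * (cp * cr ^+ 2) * (T0 * T1 * T2)
   = B ^+ 3 * T0 ^+ 3.
  rewrite -[RHS]exprMn -normU.
  transitivity ((cp * T0) ^+ 3 + (cr * T1) ^+ 3 + (cr * T2) ^+ 3
     - 3 * (cp * T0 * (cr * T1) * (cr * T2))); first by ring.
  by rewrite -e0 -e1 -e2 /cube0 /cube1 /cube2; ring.
(* The difference of the two sides of [e] is k1 T0^3 + k2 X. Its sections modulo 9 give k1 ca + k2 =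
   0 and k1 cc + k2 = 0, and ca differs from cc. *)
pose k1 := cp ^+ 3 - cr ^+ 3 - B ^+ 3.
pose k2 := cr ^+ 3 * p' - 3 * (cp * cr ^+ 2) * cx.
have ek : (k1 * ca + k2) * X0 + (k1 * cc + k2) * X1 + (k1 * cc + k2) * X2 = 0 + 0 + 0.
  transitivity (cp ^+ 3 * T0 ^+ 3 + cr ^+ 3 * (T1 ^+ 3 + T2 ^+ 3)
     - 3 * (cp * cr ^+ 2) * (T0 * T1 * T2) - B ^+ 3 * T0 ^+ 3); last first.
    by rewrite e subrr !addr0.
  rewrite theta3_0_cube theta3_1_cube theta3_2_cube theta3_prod phi3_theta_decomp /k1 /k2 /p'.
  by ring.
have pp := pure_cp; have pr := pure_cr; have pa := pure_ca; have pc := pure_cc; have px := pure_cx.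
have pB : pure zdeg 0 0 B by apply: pure_chi; rewrite /p'; pure0 zdegD.
have pka : pure zdeg 9 0 (k1 * ca + k2) by apply: pure_qseries; rewrite /k1 /k2 /p'; pure0 zdegD.
have pkc : pure zdeg 9 0 (k1 * cc + k2) by apply: pure_qseries; rewrite /k1 /k2 /p'; pure0 zdegD.
have [] := @pure_sum3_inj zdeg 9 (3 * 0) (3 * 1) (3 * 2) _ _ _ 0 0 0
  (pureM0 zdegD pka (@pure_theta9 0)) (pureM0 zdegD pkc (@pure_theta9 1))
  (pureM0 zdegD pkc (@pure_theta9 2)) (@pure0 _ _ _) (@pure0 _ _ _) (@pure0 _ _ _) isT isT isT ek.
case/bis_mulf_eq0 => [ka|/theta9_0_neq0 //].
case/bis_mulf_eq0 => [kc|/theta9_1_neq0 //] _.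
have k1_0 : k1 = 0.
  have : k1 * (ca - cc) = 0.
    have -> : k1 * (ca - cc) = (k1 * ca + k2) - (k1 * cc + k2) by ring.
    by rewrite ka kc subrr.
  case/bis_mulf_eq0 => // /head_neq0; case.
  by rewrite rmorphB /= head_ca head_cc.
have k2_0 : k2 = 0 by move: ka; rewrite k1_0 mul0r add0r.
have : cr * (cr * (cr * p' - 3 * (cp * cx))) = 0 by rewrite -k2_0 /k2; ring.
case/bis_mulf_eq0 => [/cr_neq0 //|]; case/bis_mulf_eq0 => [/cr_neq0 //|].
by move/eqP; rewrite subr_eq0 => /eqP.
Qed.

(* phi3 triples the order of vanishing. *)
Lemma phi3_contraction f g h : head g = 1 -> head f = 0 -> f * g + h * phi3 f = 0 -> f = 0.
Proof.
move=> hg hf e; apply: vanish_eq0.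
suff step d : vanish 0 d.+1 f -> vanish 0 d.+2 f.
  have all d : vanish 0 d.+1 f by elim: d => [|d /step //]; apply: vanish1_head.
  by move=> d; apply: vanish_le (all d).
move=> vf; have -> : f = f * (1 - g) - h * phi3 f.
  by apply/eqP; rewrite -subr_eq0 -e; apply/eqP; ring.
apply: vanishD.
  rewrite -(addn1 d.+1); apply: vanishM => //; apply: vanish1_head.
  by rewrite -headE rmorphB rmorph1 /= hg subrr.
apply: vanishN; rewrite mulrC; apply: vanishMr.
have [fg f0] := phi3_transports f.
move=> [w1 w2] dw; rewrite zcoef_phi3 /=; case: ifP => // d3.
have [n|n] := boolP ((w1 < 0) || (w2 < 0)); first by rewrite zcoef_neg //=; lia.
by apply: vf => /=; move: dw => /=; lia.
Qed.

(** Put p' = ca + 2 cc. The dissection of [cp] and the image of [norm_relation] under [phi3] give ca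
    cp = p' phi3(p'). As ca = phi3(cp), the difference f = cp - p' satisfies f phi3(cp) + p' phi3(f)
    = 0, and [phi3_contraction] applies. *)
Lemma cp_eq : cp = ca + 2 * cc.
Proof.
pose p' := ca + 2 * cc.
have e1 : cp = phi3 p' + 6 * phi3 cx.
  by rewrite {1}cp_dissection rmorphD rmorphM rmorph_nat.
have e2 : cc * phi3 p' = 3 * (ca * phi3 cx).
  have := congr1 phi3 norm_relation; rewrite -/p' !rmorphM /= => ->.
  by rewrite rmorph_nat.
have e3 : ca * cp = p' * phi3 p'.
  have -> : ca * cp = ca * phi3 p' + 2 * (3 * (ca * phi3 cx)) by rewrite e1; ring.
  by rewrite -e2 /p'; ring.
apply/eqP; rewrite -subr_eq0; apply/eqP.
apply: (@phi3_contraction _ (phi3 cp) p').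
- by rewrite head_phi3 head_cp.
- rewrite -/p' rmorphB /p' rmorphD rmorphM rmorph_nat /= head_cp head_ca head_cc.
  by rewrite mulr0 addr0 subrr.
- rewrite -/p' rmorphB /= -/ca mulrBl mulrBr -e3 [cp * _]mulrC; ring.
Qed.

Lemma cr_eq : cr = 3 * cx.
Proof.
have := norm_relation; rewrite -cp_eq => e.
have hp : cp <> 0 by apply: head_neq0; rewrite head_cp.
by apply: (bis_mulfI hp); rewrite mulrC e; ring.
Qed.

(** * The infinite product *)

(** The monomials are s^(j+1) t^j = z q^(j+1) and, in [tfac], s^j t^(j+1) = z^-1 q^j. *)
Definition sfac (N : nat) : bis := \prod_(j < N) (1 + mono j.+1 j).
Definition tfac (N : nat) : bis := \prod_(j < N) (1 + mono j j.+1).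
Definition fprod (N : nat) : bis := sfac N * tfac N.

Lemma vanish_mono a b d : (d <= a + b)%N -> vanish 0 d (mono a b).
Proof.
move=> dab u du; rewrite zcoef_mono.
by case: eqP => [e|//]; move: du; rewrite e /=; lia.
Qed.

Lemma vanish_refl d f : vanish 0 d (f - f).
Proof. by rewrite subrr => u _; rewrite zcoef0. Qed.

Lemma vanish_trans m d f g h : vanish m d (f - g) -> vanish m d (g - h) -> vanish m d (f - h).
Proof. by move=> v1 v2; have := vanishD v1 v2; rewrite addrA subrK. Qed.

Lemma vanish_mulB m d f g f' g' : vanish m d (f - f') -> vanish m d (g - g') ->
  vanish m d (f * g - f' * g').
Proof.
move=> v1 v2; have -> : f * g - f' * g' = (f - f') * g + (g - g') * f' by ring.
by apply: vanishD; apply: vanishMr.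
Qed.

Lemma vanish_expB m d f g n : vanish m d (f - g) -> vanish m d (f ^+ n - g ^+ n).
Proof. by move=> v; rewrite subrXX; apply: vanishMr. Qed.

Lemma sfac_stable N N' : (N <= N')%N -> vanish 0 (2 * N).+1 (sfac N' - sfac N).
Proof.
move=> /subnK <-; elim: (N' - N)%N => [|m IH]; first exact: vanish_refl.
rewrite addSn /sfac big_ord_recr /= mulrDr mulr1 addrAC; apply: vanishD => //.
by rewrite mulrC; apply: vanishMr; apply: vanish_mono; lia.
Qed.

Lemma tfac_stable N N' : (N <= N')%N -> vanish 0 (2 * N).+1 (tfac N' - tfac N).
Proof.
move=> /subnK <-; elim: (N' - N)%N => [|m IH]; first exact: vanish_refl.
rewrite addSn /tfac big_ord_recr /= mulrDr mulr1 addrAC; apply: vanishD => //.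
by rewrite mulrC; apply: vanishMr; apply: vanish_mono; lia.
Qed.

(** Factors of index at least N differ from 1 only in total degree at least 2N + 1, so i + j factors
    of each kind determine the coefficient of s^i t^j. *)
Definition iprod : bis := mkbis (fun i j => bcoef (fprod (i + j)) i j).

Lemma fprod_stable N N' : (N <= N')%N -> vanish 0 (2 * N).+1 (fprod N' - fprod N).
Proof. by move=> le; apply: vanish_mulB; [apply: sfac_stable|apply: tfac_stable]. Qed.

Lemma iprod_fprod N : vanish 0 (2 * N).+1 (iprod - fprod N).
Proof.
move=> [w1 w2] /= dw; rewrite dvd0z zcoefB.
have [n|n] := boolP ((w1 < 0) || (w2 < 0)); first by rewrite !zcoef_neg ?subrr.
case: w1 w2 dw n => [i|i] [j|j] // dw _.
have -> : zcoef iprod (Posz i, Posz j) = zcoef (fprod (i + j)) (Posz i, Posz j) by [].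
rewrite subr_eq0; case: (leqP (i + j) N) => le.
  by rewrite (vanish_zcoef (fprod_stable le)) //=; lia.
by rewrite (vanish_zcoef (fprod_stable (ltnW le))).
Qed.

Lemma shift_sfac N : shift 1 0 0 (\prod_(j < N) (1 + mono j.+2 j.+1)) (sfac N).
Proof.
rewrite /sfac; elim/big_ind2: _ => [|f f' g g' s1 s2|j _].
- exact: transports_one (shift_det 1).
- by have := shiftM s1 s2.
- apply: shiftD; first exact: transports_one (shift_det 1).
  by apply: (transports_mono (shift_det 1)); rewrite /lin; congr pair => /=; lia.
Qed.

Lemma shift_tfac N : shift 1 0 0 (tfac N) (\prod_(j < N) (1 + mono j.+1 j.+2)).
Proof.
rewrite /tfac; elim/big_ind2: _ => [|f f' g g' s1 s2|j _].
- exact: transports_one (shift_det 1).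
- by have := shiftM s1 s2.
- apply: shiftD; first exact: transports_one (shift_det 1).
  by apply: (transports_mono (shift_det 1)); rewrite /lin; congr pair => /=; lia.
Qed.

(** Under z -> z q the factor 1 + z^-1 becomes 1 + z^-1 q^-1, and multiplying by z q turns it into 1
    + z q, the factor that the shifted [sfac] lacks. One factor thus moves from [tfac] to [sfac]. *)
Lemma shift_fprod N : shift 1 1 1 (sfac N.+2 * tfac N) (fprod N.+1).
Proof.
have s0 : shift 1 1 1 (1 + mono 1 0) (1 + mono 0 1).
  rewrite addrC -mono00; apply: shiftD;
    apply: (transports_mono (shift_det 1)); rewrite /lin; congr pair => /=; lia.
have := shiftM s0 (shiftM (shift_sfac N.+1) (shift_tfac N)); rewrite !addr0.
have -> : (1 + mono 0 1) * (sfac N.+1 * \prod_(j < N) (1 + mono j.+1 j.+2)) = fprod N.+1.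
  by rewrite mulrCA /fprod /tfac big_ord_recl.
suff -> : (1 + mono 1 0) * (\prod_(j < N.+1) (1 + mono j.+2 j.+1) * tfac N) = sfac N.+2 * tfac N by [].
by rewrite mulrA; congr (_ * _); rewrite [RHS]big_ord_recl.
Qed.

Lemma shift_iprod : shift 1 1 1 iprod iprod.
Proof.
apply: shiftP => i j; pose v := (i + 1 * (i - j) + 1, j + 1 * (i - j) + 1 - 1).
(* N is large enough for truncated products to give the right coefficient both at [v] and at
   [(i, j)]. *)
pose N := (`|i| + `|j| + `|v.1| + `|v.2|)%N.
have ltvN : v.1 + v.2 < (2 * N).+1%:Z.
  by rewrite /N; move: (v.1) (v.2) => v1 v2; lia.
transitivity (zcoef (sfac N.+2 * tfac N) v).
  apply: vanish_zcoef ltvN.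
  apply: (@vanish_trans _ _ _ (fprod N)) (@iprod_fprod N) _; rewrite -opprB; apply: vanishN.
  by apply: vanish_mulB; [apply: sfac_stable; lia | apply: vanish_refl].
rewrite /v (shift_zcoef _ _ (shift_fprod N)); symmetry.
apply: (@vanish_zcoef (2 * N.+1).+1); first exact: iprod_fprod.
by rewrite /N /=; lia.
Qed.

Definition kappa : bis := part zdeg 0 0 iprod.

Lemma pure_kappa : pure zdeg 0 0 kappa. Proof. exact: pure_part. Qed.

(* Jacobi's triple product; kappa is the partition generating function. *)
Lemma iprod_theta : iprod = kappa * theta.
Proof.
apply/eqP; rewrite -subr_eq0; apply/eqP.
apply: (@theta_unique 1 1 1 0) => //.
  by apply: shiftD shift_iprod _; apply: shiftN; apply: shiftMl pure_kappa shift_theta.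
move=> n hn; have -> : n = 0 by lia.
by rewrite raddfB /= (@part_qseriesM _ _ _ pure_kappa) part_theta0 mulr1 subrr.
Qed.

(** The product of f(w z) over the cube roots of unity w, written in terms of sections to stay over
    the integers. *)
Definition norm3 (f : bis) : bis :=
  let f0 := part zdeg 3 0 f in let f1 := part zdeg 3 1 f in let f2 := part zdeg 3 2 f in
  f0 ^+ 3 + f1 ^+ 3 + f2 ^+ 3 - 3 * (f0 * f1 * f2).

Lemma norm3E f0 f1 f2 : pure zdeg 3 0 f0 -> pure zdeg 3 1 f1 -> pure zdeg 3 2 f2 ->
  norm3 (f0 + f1 + f2) = f0 ^+ 3 + f1 ^+ 3 + f2 ^+ 3 - 3 * (f0 * f1 * f2).
Proof.
move=> p0 p1 p2; rewrite /norm3.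
by have [-> -> ->] := part_sum3_all p0 p1 p2 isT isT isT.
Qed.

Lemma norm3M f g : norm3 (f * g) = norm3 f * norm3 g.
Proof.
rewrite {1}(part3_decomp f) {1}(part3_decomp g) /norm3.
have pf r := @pure_part zdeg 3 r f; have pg r := @pure_part zdeg 3 r g.
move: (part _ _ 0 f) (part _ _ 1 f) (part _ _ 2 f) (pf 0) (pf 1) (pf 2) => f0 f1 f2 p0 p1 p2.
move: (part _ _ 0 g) (part _ _ 1 g) (part _ _ 2 g) (pg 0) (pg 1) (pg 2) => g0 g1 g2 q0 q1 q2.
have -> : (f0 + f1 + f2) * (g0 + g1 + g2) = (f0 * g0 + f1 * g2 + f2 * g1)
   + (f0 * g1 + f1 * g0 + f2 * g2) + (f0 * g2 + f1 * g1 + f2 * g0) by ring.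
have pM r1 r2 r a b := @pureM_mod zdeg 3 r1 r2 r a b zdegD.
have [] := part_sum3_all (_ : pure zdeg 3 0 (f0 * g0 + f1 * g2 + f2 * g1))
  (_ : pure zdeg 3 1 (f0 * g1 + f1 * g0 + f2 * g2))
  (_ : pure zdeg 3 2 (f0 * g2 + f1 * g1 + f2 * g0)) isT isT isT.
- by do 2?[apply: pureD]; [apply: pM p0 q0 _|apply: pM p1 q2 _|apply: pM p2 q1 _].
- by do 2?[apply: pureD]; [apply: pM p0 q1 _|apply: pM p1 q0 _|apply: pM p2 q2 _].
- by do 2?[apply: pureD]; [apply: pM p0 q2 _|apply: pM p1 q1 _|apply: pM p2 q0 _].
by move=> -> -> ->; ring.
Qed.

Lemma pure_mono a b : pure zdeg 0 (a%:Z - b%:Z) (mono a b).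
Proof.
move=> u; rewrite zcoef_mono; case: (eqVneq u _) => [-> _|//].
by rewrite /zdeg /= subrr.
Qed.

Lemma phi3_mono a b : phi3 (mono a b) = mono (3 * a) (3 * b).
Proof.
apply: (transports_uniq (a := 3) (b := 0) (c := 0) (d := 3)) (phi3_transports _) _.
by apply: transports_mono => //; rewrite /lin; congr pair => /=; lia.
Qed.

Lemma mono_cube a b : mono a b ^+ 3 = mono (3 * a) (3 * b).
Proof. by rewrite !exprS expr0 mulr1 !monoM; congr mono; lia. Qed.

(** A factor 1 + m, with m a monomial of z-degree 1, has norm 1 + m^3, its image under [phi3]; the
    norm is multiplicative. *)
Lemma norm3_sfac N : norm3 (sfac N) = phi3 (sfac N).
Proof.
have p0 m := @pure0 zdeg m.
elim: N => [|N IH]; rewrite /sfac ?big_ord0 ?big_ord_recr /=.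
  have := norm3E (pure1 zdegD 3) (p0 3 1) (p0 3 2); rewrite !addr0 => ->.
  by rewrite expr1n !expr0n /= ?mulr0 ?(addr0, subr0) rmorph1.
rewrite norm3M -/(sfac N) IH rmorphM; congr (_ * _) => /=.
have p1 : pure zdeg 3 1 (mono N.+1 N).
  by apply: pure_mod (pure_dvd (@pure_mono _ _) _) _; rewrite ?dvdz0 //; lia.
have := norm3E (pure1 zdegD 3) p1 (p0 3 2); rewrite addr0 => ->.
by rewrite expr1n expr0n /= ?mulr0 ?(addr0, subr0) rmorphD rmorph1 mono_cube /= phi3_mono.
Qed.

Lemma norm3_tfac N : norm3 (tfac N) = phi3 (tfac N).
Proof.
have p0 m := @pure0 zdeg m.
elim: N => [|N IH]; rewrite /tfac ?big_ord0 ?big_ord_recr /=.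
  have := norm3E (pure1 zdegD 3) (p0 3 1) (p0 3 2); rewrite !addr0 => ->.
  by rewrite expr1n !expr0n /= ?mulr0 ?(addr0, subr0) rmorph1.
rewrite norm3M -/(tfac N) IH rmorphM; congr (_ * _) => /=.
have p2 : pure zdeg 3 2 (mono N N.+1).
  by apply: pure_mod (pure_dvd (@pure_mono _ _) _) _; rewrite ?dvdz0 //; lia.
have := norm3E (pure1 zdegD 3) (p0 3 1) p2; rewrite addr0 => ->.
by rewrite expr1n expr0n /= ?(mulr0, mul0r) ?(addr0, subr0) rmorphD rmorph1 mono_cube /= phi3_mono.
Qed.

Lemma vanish_part l m r m' d f : vanish m' d f -> vanish m' d (part l m r f).
Proof. by move=> vf u du; rewrite zcoef_part; case: ifP => // _; apply: vf. Qed.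

Lemma norm3_vanish d f g : vanish 0 d (f - g) -> vanish 0 d (norm3 f - norm3 g).
Proof.
move=> v; have vp r : vanish 0 d (part zdeg 3 r f - part zdeg 3 r g).
  by rewrite -raddfB; apply: vanish_part.
rewrite /norm3; move: (part _ _ 0 f) (part _ _ 1 f) (part _ _ 2 f)
  (part _ _ 0 g) (part _ _ 1 g) (part _ _ 2 g) (vp 0) (vp 1) (vp 2) => f0 f1 f2 g0 g1 g2 v0 v1 v2.
have -> : f0 ^+ 3 + f1 ^+ 3 + f2 ^+ 3 - 3 * (f0 * f1 * f2)
   - (g0 ^+ 3 + g1 ^+ 3 + g2 ^+ 3 - 3 * (g0 * g1 * g2))
  = (f0 ^+ 3 - g0 ^+ 3) + (f1 ^+ 3 - g1 ^+ 3) + (f2 ^+ 3 - g2 ^+ 3)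
    - (f0 * f1 * f2 - g0 * g1 * g2) * 3 by ring.
have vX a b : vanish 0 d (a - b) -> vanish 0 d (a ^+ 3 - b ^+ 3) by apply: vanish_expB.
apply: vanishD; first exact: vanishD (vanishD (vX _ _ v0) (vX _ _ v1)) (vX _ _ v2).
by apply: vanishN; apply: vanishMr; apply: vanish_mulB => //; apply: vanish_mulB.
Qed.

Lemma norm3_iprod : norm3 iprod = phi3 iprod.
Proof.
apply/eqP; rewrite -subr_eq0; apply/eqP; apply: vanish_eq0 => d.
have v : vanish 0 d (iprod - fprod d) by apply: vanish_le (@iprod_fprod d); lia.
apply: (@vanish_trans _ _ _ (norm3 (fprod d))) (norm3_vanish v) _.
rewrite /fprod norm3M norm3_sfac norm3_tfac -rmorphM -raddfB /=; apply: vanish_phi3.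
by rewrite -opprB; apply: vanishN.
Qed.

(** In [norm3_iprod] with iprod = kappa theta, the left side is kappa^3 (cp - 3 cx) X and the right
    side phi3(kappa) X. *)
Lemma kappa_cube : kappa ^+ 3 * (cp - 3 * cx) = phi3 kappa.
Proof.
have := norm3_iprod; rewrite iprod_theta {1}theta_decomp !mulrDr.
have pk := @pure_qseries 3 _ pure_kappa.
have pM r f := @pureM0 zdeg 3 r kappa f zdegD pk.
rewrite (norm3E (pM _ _ (@pure_theta3 0)) (pM _ _ (@pure_theta3 1)) (pM _ _ (@pure_theta3 2))).
have -> : (kappa * T0) ^+ 3 + (kappa * T1) ^+ 3 + (kappa * T2) ^+ 3 -
    3 * (kappa * T0 * (kappa * T1) * (kappa * T2))
  = kappa ^+ 3 * (T0 ^+ 3 + T1 ^+ 3 + T2 ^+ 3 - 3 * (T0 * T1 * T2)) by ring.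
rewrite theta3_cube_sum theta3_prod -cp_eq rmorphM /=.
have X0n : phi3 theta <> 0 by apply: (@zcoef_neq0 _ (0, 0)); rewrite zcoef_phi3_theta.
by move=> e; apply: (bis_mulfI X0n); rewrite [RHS]mulrC -e; ring.
Qed.

(** * The constant term of theta^18 *)

Definition cy : bis := phi3 cx.
Definition sigma : bis := part zdeg 0 0 (X0 ^+ 2).
Definition tau : bis := part zdeg 0 0 (X1 * X2).

Lemma pure_cy : pure zdeg 0 0 cy. Proof. exact: pure_phi3_qseries pure_cx. Qed.

Lemma cc_eq : cc = 3 * cy.
Proof. by rewrite /cc cr_eq rmorphM rmorph_nat. Qed.

Lemma cx_cube_cy : cx ^+ 3 = cy * (ca ^+ 2 + 3 * (ca * cy) + 9 * cy ^+ 2).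
Proof.
have n3 : (3 : bis) <> 0 by apply: head_neq0; rewrite rmorph_nat.
by apply: (bis_mulfI n3); rewrite -cx_cube cc_eq; ring.
Qed.

(* X0, X1, X2 live in the z-degrees 0, 3, 6 modulo 9. *)
Lemma part_bilinear a0 a1 a2 b0 b1 b2 :
  pure zdeg 0 0 a0 -> pure zdeg 0 0 a1 -> pure zdeg 0 0 a2 ->
  pure zdeg 0 0 b0 -> pure zdeg 0 0 b1 -> pure zdeg 0 0 b2 ->
  part zdeg 0 0 ((a0 * X0 + a1 * X1 + a2 * X2) * (b0 * X0 + b1 * X1 + b2 * X2))
  = a0 * b0 * sigma + (a1 * b2 + a2 * b1) * tau.
Proof.
move=> pa0 pa1 pa2 pb0 pb1 pb2.
have -> : (a0 * X0 + a1 * X1 + a2 * X2) * (b0 * X0 + b1 * X1 + b2 * X2)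
  = a0 * b0 * X0 ^+ 2 + (a1 * b2 + a2 * b1) * (X1 * X2)
  + (a0 * b1 + a1 * b0) * (X0 * X1) + (a0 * b2 + a2 * b0) * (X0 * X2)
  + a1 * b1 * X1 ^+ 2 + a2 * b2 * X2 ^+ 2 by ring.
have pM r1 r2 f g := @pureM zdeg zdegD 9 r1 r2 f g.
have p0 := @pure_theta9 0; have p1 := @pure_theta9 1; have p2 := @pure_theta9 2.
have qM f g : pure zdeg 0 0 f -> part zdeg 0 0 (f * g) = f * part zdeg 0 0 g by apply: part_qseriesM.
have z01 : part zdeg 0 0 (X0 * X1) = 0 by apply: (part_eq0 (pM _ _ _ _ p0 p1)).
have z02 : part zdeg 0 0 (X0 * X2) = 0 by apply: (part_eq0 (pM _ _ _ _ p0 p2)).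
have z11 : part zdeg 0 0 (X1 ^+ 2) = 0 by apply: (part_eq0 (pM _ _ _ _ p1 p1)).
have z22 : part zdeg 0 0 (X2 ^+ 2) = 0 by apply: (part_eq0 (pM _ _ _ _ p2 p2)).
rewrite !raddfD /= (qM (a0 * b0)); last by pure0 zdegD.
rewrite (qM (a1 * b2 + a2 * b1)); last by pure0 zdegD.
rewrite (qM (a0 * b1 + a1 * b0)); last by pure0 zdegD.
rewrite (qM (a0 * b2 + a2 * b0)); last by pure0 zdegD.
rewrite (qM (a1 * b1)); last by pure0 zdegD.
rewrite (qM (a2 * b2)); last by pure0 zdegD.
by rewrite z01 z02 z11 z22 !mulr0 !addr0.
Qed.

(* In (u + v + w)^6 = ((u + v + w)^3)^2, the part of z-degree 0 modulo 3 is
   S^2 + 30 m S + 18 e + 90 m^2, where S and e are the first two elementary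
   symmetric functions of u^3, v^3, w^3 and m = u v w. *)
Definition sigma_form (A v' m : bis) : bis :=
  (A + v' + v') * (A + v' + v' + 30 * m) + (18 * (A * (v' + v')) + 18 * (v' * v'))
  + 90 * (m * m).

(** The two forms give the coefficients of [sigma] and [tau] when u^3 = A X0 + A' (X1 + X2), v^3 and
    w^3 have coefficient [v] at X1, respectively X2, and [v'] elsewhere, and u v w = m X. The first
    argument of [tau_form] stands for A'. *)
Definition tau_form (A v v' m : bis) : bis :=
  2 * ((A + v + v') * (A + v + v' + 30 * m)) +
  (18 * (2 * (A * (v + v'))) + 18 * (v * v + v' * v')) + 90 * (2 * (m * m)).

Definition sextic (u0 u1 u2 w : bis) : bis :=
  (u0 + u1 + u2) * (u0 + u1 + u2 + 30 * w) + (18 * (u0 * (u1 + u2)) + 18 * (u1 * u2))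
  + 90 * (w * w).

Lemma cube_sextic f0 f1 f2 :
  cube0 f0 f1 f2 ^+ 2 + 2 * (cube1 f0 f1 f2 * cube2 f0 f1 f2)
  = sextic (f0 ^+ 3) (f1 ^+ 3) (f2 ^+ 3) (f0 * f1 * f2).
Proof. by rewrite /cube0 /cube1 /cube2 /sextic; ring. Qed.

Lemma part_lin f1 f2 f3 f4 :
  part zdeg 0 0 (f1 + (18 * f2 + 18 * f3) + 90 * f4) = part zdeg 0 0 f1 +
  (18 * part zdeg 0 0 f2 + 18 * part zdeg 0 0 f3) + 90 * part zdeg 0 0 f4.
Proof.
have partn n f : part zdeg 0 0 (n%:R * f) = n%:R * part zdeg 0 0 f.
  by apply: part_qseriesM; apply: (@pure_nat _ _ _ zdegD).
have partD f g : part zdeg 0 0 (f + g) = part zdeg 0 0 f + part zdeg 0 0 g by apply: raddfD.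
by rewrite !partD !partn.
Qed.

Lemma part_sextic A A' v v' m :
  pure zdeg 0 0 A -> pure zdeg 0 0 A' -> pure zdeg 0 0 v -> pure zdeg 0 0 v' ->
  pure zdeg 0 0 m ->
  part zdeg 0 0 (sextic (A * X0 + A' * X1 + A' * X2) (v' * X0 + v * X1 + v' * X2)
    (v' * X0 + v' * X1 + v * X2) (m * X0 + m * X1 + m * X2))
  = sigma_form A v' m * sigma + tau_form A' v v' m * tau.
Proof.
move=> pA pA' pv pv' pm.
have -> : sextic (A * X0 + A' * X1 + A' * X2) (v' * X0 + v * X1 + v' * X2)
    (v' * X0 + v' * X1 + v * X2) (m * X0 + m * X1 + m * X2) =
    ((A + v' + v') * X0 + (A' + v + v') * X1 + (A' + v + v') * X2) *
    ((A + v' + v' + 30 * m) * X0 + (A' + v + v' + 30 * m) * X1 + (A' + v + v' + 30 * m) * X2)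
  + (18 * ((A * X0 + A' * X1 + A' * X2) *
           ((v' + v') * X0 + (v + v') * X1 + (v + v') * X2))
   + 18 * ((v' * X0 + v * X1 + v' * X2) * (v' * X0 + v' * X1 + v * X2)))
  + 90 * ((m * X0 + m * X1 + m * X2) * (m * X0 + m * X1 + m * X2)).
  by rewrite /sextic; move: X0 X1 X2 => x0 x1 x2; ring.
rewrite part_lin (part_bilinear pm pm pm pm pm pm) (part_bilinear pv' pv pv' pv' pv' pv).
rewrite (@part_bilinear A A' A' (v' + v')) //; try by pure0 zdegD.
rewrite part_bilinear; try by pure0 zdegD.
by rewrite /sigma_form /tau_form; move: sigma tau => x x'; ring.
Qed.

Lemma part_sqr x0 x1 x2 : pure zdeg 3 0 x0 -> pure zdeg 3 1 x1 -> pure zdeg 3 2 x2 ->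
  part zdeg 0 0 ((x0 + x1 + x2) ^+ 2) = part zdeg 0 0 (x0 ^+ 2 + 2 * (x1 * x2)).
Proof.
move=> p0 p1 p2.
have -> : (x0 + x1 + x2) ^+ 2 = x0 ^+ 2 + 2 * (x1 * x2)
   + (2 * (x0 * x1) + x2 ^+ 2) + (2 * (x0 * x2) + x1 ^+ 2) by ring.
have pM r1 r2 r f g := @pureM_mod zdeg 3 r1 r2 r f g zdegD.
have pn := @pure_nat zdeg 3 2 zdegD.
have d1 : pure zdeg 3 1 (2 * (x0 * x1) + x2 ^+ 2).
  by apply: pureD; [apply: (pureM0 zdegD pn); apply: pM p0 p1 _|apply: (pM _ _ _ _ _ p2 p2)].
have d2 : pure zdeg 3 2 (2 * (x0 * x2) + x1 ^+ 2).
  by apply: pureD; [apply: (pureM0 zdegD pn); apply: pM p0 p2 _|apply: (pM _ _ _ _ _ p1 p1)].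
by rewrite 2!raddfD /= (part_eq0 d1) // (part_eq0 d2) // !addr0.
Qed.

(** The cofactor of a - 3 y in a^3 - 27 y^3; by [cx_cube_cy], x^3 = y disc. *)
Definition disc (a y : bis) : bis := a ^+ 2 + 3 * (a * y) + 9 * y ^+ 2.

(** The form for u = cp T0, v = cr T1, w = cr T2, with cp = a + 6 y, cc = 3 y and cr^3 = 27 y
    disc. *)
Definition sigma_coef (a y : bis) : bis :=
  sigma_form ((a + 6 * y) ^+ 3 * a) (27 * (y * disc a y) * (3 * y))
    (9 * ((a + 6 * y) * (y * disc a y))).

Definition tau_coef (a y : bis) : bis :=
  tau_form ((a + 6 * y) ^+ 3 * (3 * y)) (27 * (y * disc a y) * a)
    (27 * (y * disc a y) * (3 * y)) (9 * ((a + 6 * y) * (y * disc a y))).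

Lemma part_chi_theta_18 :
  part zdeg 0 0 (chi theta ^+ 18) = sigma_coef ca cy * sigma + tau_coef ca cy * tau.
Proof.
have pcp := pure_cp; have pcr := pure_cr.
have q0 : pure zdeg 3 0 (cp * T0) := pureM0 zdegD (@pure_qseries 3 _ pure_cp) (@pure_theta3 0).
have q1 : pure zdeg 3 1 (cr * T1) := pureM0 zdegD (@pure_qseries 3 _ pure_cr) (@pure_theta3 1).
have q2 : pure zdeg 3 2 (cr * T2) := pureM0 zdegD (@pure_qseries 3 _ pure_cr) (@pure_theta3 2).
have -> : chi theta ^+ 18 = ((cp * T0 + cr * T1 + cr * T2) ^+ 3) ^+ 2.
  by rewrite -chi_theta_cube -!exprM.
rewrite cubeE (part_sqr (pure_cube0 q0 q1 q2) (pure_cube1 q0 q1 q2) (pure_cube2 q0 q1 q2)).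
rewrite cube_sextic.
have pa := pure_ca; have py := pure_cy.
have ecp : cp = ca + 6 * cy by rewrite cp_eq cc_eq; ring.
have ecr : cr ^+ 3 = 27 * (cy * disc ca cy) by rewrite cr_eq exprMn cx_cube_cy /disc; ring.
have -> : cp * T0 * (cr * T1) * (cr * T2) = 9 * (cp * (cy * disc ca cy)) * X0
    + 9 * (cp * (cy * disc ca cy)) * X1 + 9 * (cp * (cy * disc ca cy)) * X2.
  transitivity (9 * (cp * cx ^+ 3) * phi3 theta).
    rewrite cr_eq; transitivity (9 * (cp * cx ^+ 2) * (T0 * T1 * T2)).
      by move: T0 T1 T2 => x0 x1 x2; ring.
    by rewrite theta3_prod; ring.
  by rewrite cx_cube_cy -/(disc ca cy) phi3_theta_decomp; ring.
have pd : pure zdeg 0 0 (disc ca cy) by rewrite /disc; pure0 zdegD.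
rewrite !exprMn theta3_0_cube theta3_1_cube theta3_2_cube cc_eq ecr.
rewrite /sigma_coef /tau_coef -ecp; move: (disc ca cy) pd => d pd.
have -> : cp ^+ 3 * (ca * X0 + 3 * cy * (X1 + X2)) =
    cp ^+ 3 * ca * X0 + cp ^+ 3 * (3 * cy) * X1 + cp ^+ 3 * (3 * cy) * X2 by ring.
have -> : 27 * (cy * d) * (ca * X1 + 3 * cy * (X2 + X0)) = 27 * (cy * d) * (3 * cy) * X0
    + 27 * (cy * d) * ca * X1 + 27 * (cy * d) * (3 * cy) * X2 by ring.
have -> : 27 * (cy * d) * (ca * X2 + 3 * cy * (X0 + X1)) = 27 * (cy * d) * (3 * cy) * X0
    + 27 * (cy * d) * (3 * cy) * X1 + 27 * (cy * d) * ca * X2 by ring.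
by apply: part_sextic; pure0 zdegD.
Qed.

(* [sigma_part] and [tau_part] collect the coefficients of disc^6 sigma_coef and
   of disc^6 tau_coef by the exponent of y modulo 3, with Y = y^3.  Integers are
   written in base 1000 because numerals in a ring are unary. *)
Definition sigma_part0 (a Y : bis) : bis :=
  a ^+ 18
  + (717 * 1000 + 174) * a ^+ 15 * Y
  + (((1 * 1000 + 341) * 1000 + 958) * 1000 + 509) * a ^+ 12 * Y ^+ 2
  + (((265 * 1000 + 499) * 1000 + 26) * 1000 + 884) * a ^+ 9 * Y ^+ 3
  + ((((10 * 1000 + 831) * 1000 + 337) * 1000 + 816) * 1000 + 193) * a ^+ 6 * Y ^+ 4
  + ((((99 * 1000 + 508) * 1000 + 91) * 1000 + 665) * 1000 + 230) * a ^+ 3 * Y ^+ 5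
  + ((((145 * 1000 + 137) * 1000 + 788) * 1000 + 112) * 1000 + 114) * Y ^+ 6.
Definition sigma_part1 (a Y : bis) : bis :=
  4 * a ^+ 18
  + (154 * 1000 + 62) * a ^+ 15 * Y
  + ((117 * 1000 + 634) * 1000 + 356) * a ^+ 12 * Y ^+ 2
  + (((13 * 1000 + 288) * 1000 + 642) * 1000 + 839) * a ^+ 9 * Y ^+ 3
  + (((332 * 1000 + 492) * 1000 + 873) * 1000 + 4) * a ^+ 6 * Y ^+ 4
  + ((((1 * 1000 + 774) * 1000 + 730) * 1000 + 213) * 1000 + 388) * a ^+ 3 * Y ^+ 5
  + ((((1 * 1000 + 80) * 1000 + 128) * 1000 + 323) * 1000 + 332) * Y ^+ 6.
Definition sigma_part2 (a Y : bis) : bis :=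
  11 * a ^+ 18
  + (68 * 1000 + 256) * a ^+ 15 * Y
  + ((25 * 1000 + 220) * 1000 + 484) * a ^+ 12 * Y ^+ 2
  + (((1 * 1000 + 692) * 1000 + 580) * 1000 + 536) * a ^+ 9 * Y ^+ 3
  + (((25 * 1000 + 884) * 1000 + 365) * 1000 + 346) * a ^+ 6 * Y ^+ 4
  + (((75 * 1000 + 762) * 1000 + 228) * 1000 + 960) * a ^+ 3 * Y ^+ 5
  + (((13 * 1000 + 172) * 1000 + 296) * 1000 + 626) * Y ^+ 6.
Definition tau_part0 (a Y : bis) : bis :=
  (19 * 1000 + 440) * a ^+ 15 * Y
  + ((34 * 1000 + 239) * 1000 + 672) * a ^+ 12 * Y ^+ 2
  + (((6 * 1000 + 538) * 1000 + 377) * 1000 + 672) * a ^+ 9 * Y ^+ 3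
  + (((265 * 1000 + 980) * 1000 + 906) * 1000 + 90) * a ^+ 6 * Y ^+ 4
  + ((((2 * 1000 + 481) * 1000 + 729) * 1000 + 559) * 1000 + 92) * a ^+ 3 * Y ^+ 5
  + ((((3 * 1000 + 705) * 1000 + 289) * 1000 + 556) * 1000 + 796) * Y ^+ 6.
Definition tau_part1 (a Y : bis) : bis :=
  (12 * 1000 + 354) * a ^+ 15 * Y
  + ((8 * 1000 + 856) * 1000 + 540) * a ^+ 12 * Y ^+ 2
  + ((978 * 1000 + 105) * 1000 + 132) * a ^+ 9 * Y ^+ 3
  + (((24 * 1000 + 584) * 1000 + 696) * 1000 + 856) * a ^+ 6 * Y ^+ 4
  + (((133 * 1000 + 776) * 1000 + 454) * 1000 + 284) * a ^+ 3 * Y ^+ 5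
  + (((83 * 1000 + 338) * 1000 + 451) * 1000 + 856) * Y ^+ 6.
Definition tau_part2 (a Y : bis) : bis :=
  (48 * 1000 + 618) * a ^+ 18
  + ((315 * 1000 + 318) * 1000 + 744) * a ^+ 15 * Y
  + (((110 * 1000 + 829) * 1000 + 28) * 1000 + 734) * a ^+ 12 * Y ^+ 2
  + ((((7 * 1000 + 350) * 1000 + 861) * 1000 + 442) * 1000 + 716) * a ^+ 9 * Y ^+ 3
  + ((((113 * 1000 + 608) * 1000 + 877) * 1000 + 365) * 1000 + 386) * a ^+ 6 * Y ^+ 4
  + ((((339 * 1000 + 959) * 1000 + 929) * 1000 + 415) * 1000 + 544) * a ^+ 3 * Y ^+ 5
  + ((((60 * 1000 + 70) * 1000 + 321) * 1000 + 660) * 1000 + 428) * Y ^+ 6.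

(** Multiplying by disc^6 turns the denominator (a - 3 y)^6, which stems from kappa, into (a^3 - 27
    y^3)^6, where y occurs only through y^3. *)
Lemma sigma_dissection a y :
  disc a y ^+ 6 * sigma_coef a y =
  a ^+ 2 * sigma_part0 a (y ^+ 3) + 81 * (a * y * sigma_part1 a (y ^+ 3))
  + 2187 * (y ^+ 2 * sigma_part2 a (y ^+ 3)).
Proof.
rewrite /sigma_coef /sigma_form /disc /sigma_part0 /sigma_part1 /sigma_part2; ring.
Qed.

(** As [tau] contributes a further q^3, the classes are rotated against those of [sigma_dissection]:
    the exponents 0, 1, 2 of y belong to the residues 1, 2, 0 of n. *)
Lemma tau_dissection a y :
  disc a y ^+ 6 * tau_coef a y =
  81 * (a ^+ 2 * tau_part0 a (y ^+ 3)) + 2187 * (a * y * tau_part1 a (y ^+ 3))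
  + y ^+ 2 * tau_part2 a (y ^+ 3).
Proof.
rewrite /tau_coef /tau_form /disc /tau_part0 /tau_part1 /tau_part2; ring.
Qed.

(** * Generalized Frobenius partitions *)

Lemma zcoef_sum (I : finType) (P : pred I) (F : I -> bis) u :
  zcoef (\sum_(i | P i) F i) u = \sum_(i | P i) zcoef (F i) u.
Proof. by elim/big_rec2: _ => [|i x y _ <-]; rewrite ?zcoef0 ?zcoefD. Qed.

Lemma prod_mono (I : finType) (P : pred I) (f g : I -> nat) :
  \prod_(i | P i) mono (f i) (g i) = mono (\sum_(i | P i) f i) (\sum_(i | P i) g i).
Proof. by elim/big_rec3: _ => [|i x y z _ ->]; rewrite ?mono00 // monoM. Qed.

Lemma prod_add1 (I : finType) (f : I -> bis) :
  \prod_i (1 + f i) = \sum_(A : {set I}) \prod_(i in A) f i.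
Proof.
under eq_bigr do rewrite addrC.
rewrite bigA_distr; apply: eq_bigr => A _.
by rewrite [RHS]big_mkcond.
Qed.

Lemma prod_colors (k n : nat) (f : nat -> bis) :
  (\prod_(j < n) f j) ^+ k = \prod_(x : 'I_n * 'I_k) f x.1.
Proof.
rewrite -(pair_bigA _ (fun (i : 'I_n) (_ : 'I_k) => f i)) /=.
by rewrite -prodrXl; apply: eq_bigr => i _; rewrite prodr_const card_ord.
Qed.

(** Expanding over subsets of pairs (entry, color), rows A and B contribute s^(|A| + sum A + sum B)
    t^(|B| + sum A + sum B). The exponent (n, n) forces equal lengths and weight n; its total degree
    2n is below the order 2n + 1 to which [fprod n] is exact. *)
Lemma zcoef_iprodX k n : zcoef (iprod ^+ k) (n%:Z, n%:Z) = (cphi k n)%:Z.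
Proof.
have v := vanish_expB k (@iprod_fprod n).
rewrite (vanish_zcoef v) /=; last by lia.
rewrite /fprod exprMn /sfac /tfac.
rewrite (prod_colors k n (fun j => 1 + mono j.+1 j)) (prod_colors k n (fun j => 1 + mono j j.+1)).
rewrite !prod_add1 big_distrlr /= pair_big /= zcoef_sum.
have -> : (cphi k n)%:Z = \sum_p (p \in gen_frob_partitions k n)%:R.
  rewrite -natz /cphi -sum1_card natr_sum big_mkcond /=.
  by apply: eq_bigr => p _; case: (_ \in _).
apply: eq_bigr => -[A B] _ /=.
rewrite !prod_mono monoM zcoef_mono xpair_eqE !eqz_nat inE /=; congr (nat_of_bool _)%:R.
have rowS (C : colored_row k n) : \sum_(x in C) (x.1 : nat).+1 = (#|C| + row_sum C)%N.
  by rewrite -sum1_card -big_split.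
rewrite !rowS -/(row_sum A) -/(row_sum B).
by move: (row_sum A) (row_sum B) => a b; move: #|A| #|B| => x y; apply/idP/idP; lia.
Qed.

Lemma zcoefMn f n u : zcoef (n%:R * f) u = n%:Z * zcoef f u.
Proof.
elim: n => [|n IH]; first by rewrite !mul0r zcoef0.
by rewrite -natr1 mulrDl mul1r zcoefD IH intS mulrDl mul1r addrC.
Qed.

Lemma part_chi m r f : part zdeg m r (chi f) = chi (part zdeg m r f).
Proof.
apply: zcoefP => -[u1 u2]; rewrite zcoef_part !zcoef_chi zcoef_part /zdeg /=.
case: (boolP (3 %| u1 + u2)%Z) => d; last by case: ifP.
by have -> : ((2 * u1 - u2) %/ 3)%Z - ((2 * u2 - u1) %/ 3)%Z = u1 - u2 by lia.
Qed.

(** * Residues of the exponent of q modulo 9 *)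

Lemma qpure_part l m r m' r' f : pure l m r f -> pure l m r (part zdeg m' r' f).
Proof. by move=> pf u; rewrite zcoef_part; case: ifP; rewrite ?eqxx // => _ /pf. Qed.

Lemma qpure_phi3 m r f : pure qdeg m r f -> pure qdeg (3 * m) (3 * r) (phi3 f).
Proof. exact: pure_phi3 qdegD. Qed.

Lemma pure_mod1 l r f : pure l 1 r f.
Proof. by move=> u _; apply: dvd1z. Qed.

Lemma qpure_phi3_phi3 f : pure qdeg 9 0 (phi3 (phi3 f)).
Proof. exact: (qpure_phi3 (qpure_phi3 (@pure_mod1 qdeg 0 f))). Qed.

Lemma qpure_ca : pure qdeg 9 0 ca.
Proof. by rewrite /ca cp_dissection; apply: qpure_phi3_phi3. Qed.

Lemma qpure_cx : pure qdeg 3 1 cx.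
Proof.
have q0 : pure qdeg 3 0 T0 by apply: qpure_theta3; left.
have q1 : pure qdeg 3 1 T1 by apply: qpure_theta3; right; left.
have q2 : pure qdeg 3 0 T2 by apply: qpure_theta3; right; right.
by apply: qpure_part; have := pureM qdegD (pureM qdegD q0 q1) q2.
Qed.

Lemma qpure_cy : pure qdeg 9 3 cy.
Proof. exact: qpure_phi3 qpure_cx. Qed.

Lemma qpure_sigma : pure qdeg 9 0 sigma.
Proof.
have q0 : pure qdeg 3 0 T0 by apply: qpure_theta3; left.
have q : pure qdeg 9 0 X0 := qpure_phi3 q0.
by apply: qpure_part; apply: (@pureX0 _ _ _ _ qdegD).
Qed.

Lemma qpure_tau : pure qdeg 9 3 tau.
Proof.
have q1 : pure qdeg 3 1 T1 by apply: qpure_theta3; right; left.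
have q2 : pure qdeg 3 0 T2 by apply: qpure_theta3; right; right.
by apply: qpure_part; apply: (pureM_mod qdegD (qpure_phi3 q1) (qpure_phi3 q2)).
Qed.

(* ca^3 - 27 cy^3 = (ca - 3 cy) disc, and phi3 (kappa_cube) turns (ca - 3 cy)^6
   into a power of kappa. *)
Lemma chi_constant_term : chi (part zdeg 0 0 (iprod ^+ 18)) * (ca ^+ 3 - 27 * cy ^+ 3) ^+ 6 =
  phi3 (phi3 kappa) ^+ 6 * disc ca cy ^+ 6
  * (sigma_coef ca cy * sigma + tau_coef ca cy * tau).
Proof.
have pk18 : pure zdeg 0 0 (kappa ^+ 18) := @pureX0 zdeg 0 kappa 18 zdegD pure_kappa.
have e1 : part zdeg 0 0 (iprod ^+ 18) = kappa ^+ 18 * part zdeg 0 0 (theta ^+ 18).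
  have -> : iprod ^+ 18 = kappa ^+ 18 * theta ^+ 18.
    by rewrite -(exprMn 18 kappa theta) -iprod_theta.
  exact: (@part_qseriesM 0 (kappa ^+ 18) (theta ^+ 18) pk18).
have e2 : chi (part zdeg 0 0 (theta ^+ 18)) = part zdeg 0 0 (chi theta ^+ 18).
  by rewrite -part_chi; congr (part _ _ _ _); apply: rmorphXn.
have e3 : chi (kappa ^+ 18) = phi3 kappa ^+ 18.
  by rewrite -(chi_qseries pure_kappa); apply: rmorphXn.
have chiM f g : chi (f * g) = chi f * chi g by apply: rmorphM.
rewrite e1 chiM e2 e3 part_chi_theta_18.
have <- : phi3 kappa ^+ 3 * (ca - 3 * cy) = phi3 (phi3 kappa).
  by rewrite -[in RHS]kappa_cube rmorphM rmorphXn rmorphB rmorphM rmorph_nat.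
move: (_ + _ * tau) => F; rewrite /disc; ring.
Qed.

(** Since [chi] triples the exponent of q, the residue of n modulo 3 becomes that of 3n modulo 9.
    The factor (ca^3 - 27 cy^3)^6 is a series in q^9 with constant term 1, so dividing by it
    preserves the residues. *)
Lemma cphi_18_dissection : exists R0 R1 R2 : bis,
  [/\ pure qdeg 9 0 R0, pure qdeg 9 3 R1, pure qdeg 9 6 R2 &
    chi (part zdeg 0 0 (iprod ^+ 18)) = R0 + 81 * R1 + 2187 * R2].
Proof.
have pa := qpure_ca; have py := qpure_cy; have ps := qpure_sigma; have pt := qpure_tau.
have pM r1 r2 r f g := @pureM_mod qdeg 9 r1 r2 r f g qdegD.
have py2 : pure qdeg 9 6 (cy ^+ 2) by apply: (pM _ _ _ _ _ py py).
have pY : pure qdeg 9 0 (cy ^+ 3) by apply: (pM _ _ _ _ _ py py2).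
have pay : pure qdeg 9 3 (ca * cy) by apply: (pM _ _ _ _ _ pa py).
have [s0 s1 s2] : [/\ pure qdeg 9 0 (sigma_part0 ca (cy ^+ 3)),
    pure qdeg 9 0 (sigma_part1 ca (cy ^+ 3)) & pure qdeg 9 0 (sigma_part2 ca (cy ^+ 3))].
  rewrite /sigma_part0 /sigma_part1 /sigma_part2; move: (cy ^+ 3) pY => Y pY.
  by split; pure0 qdegD.
have [t0 t1 t2] : [/\ pure qdeg 9 0 (tau_part0 ca (cy ^+ 3)),
    pure qdeg 9 0 (tau_part1 ca (cy ^+ 3)) & pure qdeg 9 0 (tau_part2 ca (cy ^+ 3))].
  rewrite /tau_part0 /tau_part1 /tau_part2; move: (cy ^+ 3) pY => Y pY.
  by split; pure0 qdegD.
have [G pG GH] : exists2 G, pure qdeg 9 0 G & G * (ca ^+ 3 - 27 * cy ^+ 3) ^+ 6 = 1.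
  apply: inverse_exists qdegD _ _.
    by move: (cy ^+ 3) pY => Y pY; pure0 qdegD.
  have hX f n : head (f ^+ n) = head f ^+ n by apply: rmorphXn.
  have hB f g : head (f - g) = head f - head g by apply: rmorphB.
  have hM f g : head (f * g) = head f * head g by apply: rmorphM.
  rewrite hX hB hM !hX head_ca.
  have -> : head cy = 0.
    apply/eqP; rewrite headE; apply: contraT => /py; rewrite /qdeg /=; by [].
  by rewrite expr0n mulr0 subr0 !expr1n.
have [K pK eK] : exists2 K, pure qdeg 9 0 K & K = G * phi3 (phi3 kappa) ^+ 6.
  exists (G * phi3 (phi3 kappa) ^+ 6) => //.
  by have pk := @qpure_phi3_phi3 kappa; pure0 qdegD.
(* The six terms of the two dissections are sorted by the exponent of y, increased by one for terms
   with [tau], modulo 3. *)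
exists (K * (ca ^+ 2 * sigma_part0 ca (cy ^+ 3) * sigma + cy ^+ 2 * tau_part2 ca (cy ^+ 3) * tau)).
exists (K * (ca * cy * sigma_part1 ca (cy ^+ 3) * sigma + ca ^+ 2 * tau_part0 ca (cy ^+ 3) * tau)).
exists (K * (cy ^+ 2 * sigma_part2 ca (cy ^+ 3) * sigma + ca * cy * tau_part1 ca (cy ^+ 3) * tau)).
split.
- apply: pureM0 qdegD pK _; apply: pureD; first by move: (cy ^+ 3) s0 => Y s0; pure0 qdegD.
  have q : pure qdeg 9 6 (cy ^+ 2 * tau_part2 ca (cy ^+ 3)) by apply: (pM _ _ _ _ _ py2 t2).
  by apply: (pM _ _ _ _ _ q pt).
- apply: pureM0 qdegD pK _; apply: pureD.
    have q : pure qdeg 9 3 (ca * cy * sigma_part1 ca (cy ^+ 3)) by apply: (pM _ _ _ _ _ pay s1).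
    by apply: (pM _ _ _ _ _ q ps).
  have q : pure qdeg 9 0 (ca ^+ 2 * tau_part0 ca (cy ^+ 3)) by pure0 qdegD.
  by apply: (pM _ _ _ _ _ q pt).
- apply: pureM0 qdegD pK _; apply: pureD.
    have q : pure qdeg 9 6 (cy ^+ 2 * sigma_part2 ca (cy ^+ 3)) by apply: (pM _ _ _ _ _ py2 s2).
    by apply: (pM _ _ _ _ _ q ps).
  have q : pure qdeg 9 3 (ca * cy * tau_part1 ca (cy ^+ 3)) by apply: (pM _ _ _ _ _ pay t1).
  by apply: (pM _ _ _ _ _ q pt).
have e : chi (part zdeg 0 0 (iprod ^+ 18)) =
    K * (disc ca cy ^+ 6 * sigma_coef ca cy * sigma + disc ca cy ^+ 6 * tau_coef ca cy * tau).
  transitivity (G * (chi (part zdeg 0 0 (iprod ^+ 18)) * (ca ^+ 3 - 27 * cy ^+ 3) ^+ 6)).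
    by rewrite mulrCA GH mulr1.
  rewrite chi_constant_term eK; move: (sigma_coef _ _) (tau_coef _ _) => x x'; ring.
rewrite e sigma_dissection tau_dissection.
move: (sigma_part0 _ _) (sigma_part1 _ _) (sigma_part2 _ _)
  (tau_part0 _ _) (tau_part1 _ _) (tau_part2 _ _) => a0 a1 a2 b0 b1 b2; ring.
Qed.

Lemma zcoef_chi_diag f n : zcoef (chi f) ((3 * n)%N%:Z, (3 * n)%N%:Z) = zcoef f (n%:Z, n%:Z).
Proof. by rewrite zcoef_chi /= ifT; [congr (zcoef _ (_, _))|]; lia. Qed.

Lemma cphi_18E n : (cphi 18 n)%:Z =
  zcoef (chi (part zdeg 0 0 (iprod ^+ 18))) ((3 * n)%N%:Z, (3 * n)%N%:Z).
Proof. by rewrite zcoef_chi_diag zcoef_part /zdeg /= !subrr dvdzz zcoef_iprodX. Qed.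

Lemma pure_zcoef0 l m r f u : pure l m r f -> ~~ (m %| l u - r)%Z -> zcoef f u = 0.
Proof. by move=> pf nd; apply/eqP; apply: contraNT nd => /pf. Qed.

(** At exponent 9n + 3 only 81 R1 survives, at 9n + 6 only 2187 R2. *)
Lemma cphi_18_dvdz n :
  (81 %| (cphi 18 (3 * n + 1))%:Z)%Z /\ (2187 %| (cphi 18 (3 * n + 2))%:Z)%Z.
Proof.
have [R0 [R1 [R2 [p0 p1 p2 e]]]] := cphi_18_dissection.
have z R r N : pure qdeg 9 r R -> ~~ (9 %| (3 * N)%N%:Z - r)%Z ->
  zcoef R ((3 * N)%N%:Z, (3 * N)%N%:Z) = 0.
  by move=> pR nd; apply: (pure_zcoef0 pR).
rewrite !cphi_18E e !zcoefD !zcoefMn (z _ _ _ p0) ?(z _ _ (3 * n + 2)%N p0); try lia.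
rewrite (z _ _ (3 * n + 1)%N p2) ?(z _ _ (3 * n + 2)%N p1); lia.
Qed.

Local Close Scope ring_scope.

Theorem theorem1p3 :
  forall n : nat,
    cphi 18 (3 * n + 1) = 0 %[mod 81] /\ cphi 18 (3 * n + 2) = 0 %[mod 2187].
Proof.
move=> n; have [d1 d2] := cphi_18_dvdz n.
by rewrite !mod0n; split; apply/eqP; [move: d1|move: d2]; rewrite dvdzE.
Qed.
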